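(* There are universal constants $K_1,K_2>0$ such that for every finite metric space $(X,d_X)$ with $|X|=n\ge2$, the Lipschitz free space $\mathsf{LF}(X)$ isomorphically embeds into $\ell_1^m$, for some $m\le K_1\,n\log n$, with Banach–Mazur distortion at most $K_2\log n$.
   Context: For a finite metric space $(X,d_X)$, $\mathsf{LF}(X)$ is the vector space of functions $\mu\colon X\to\mathbb{R}$ with $\sum_{x\in X}\mu(x)=0$, equipped with the norm $$\|\mu\|_{\mathsf{LF}}=\inf\Big\{\sum_{j=1}^r|a_j|\,d_X(p_j,q_j)\colon \mu=\sum_{j=1}^r a_j(\mathbf{1}_{\{p_j\}}-\mathbf{1}_{\{q_j\}})\Big\},$$ the infimum being over all $r$, $a_j\in\mathbb{R}$ and $p_j,q_j\in X$. A Banach space $E$ isomorphically embeds into a Banach space $F$ with Banach–Mazur distortion at most $D$ if there is a linear isomorphism $T$ from $E$ onto a subspace of $F$ with $\|T\|\cdot\|T^{-1}\|\le D$ ($T^{-1}$ being defined on $T(E)$). Logarithms are base 2. *)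

(* Defs.v *)
From HB Require Import structures.
From mathcomp Require Import all_boot all_order all_algebra.
From mathcomp Require Import all_classical all_reals all_analysis.
From mathcomp Require Import lra.
Set Implicit Arguments.
Unset Strict Implicit.
Unset Printing Implicit Defensive.
Import Order.TTheory GRing.Theory Num.Def Num.Theory.
Import numFieldNormedType.Exports.
Local Open Scope classical_set_scope.
Local Open Scope ring_scope.

#[short(type="finMetricType")]
HB.structure Definition FinMetric (R : numDomainType) :=
  { X of Metric R X & Finite X }.

Definition log2 (R : realType) (x : R) : R := ln x / ln 2.

Section LipschitzFree.
Variables (R : realType) (X : finMetricType R).
Implicit Types (mu nu : {ffun X -> R^o}) (p q x : X).

Definition zero_sum : {pred {ffun X -> R^o}} :=
  [pred mu : {ffun X -> R^o} | \sum_x mu x == 0].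

Lemma zero_sum_submod : submod_closed zero_sum.
Proof.
split; first by rewrite inE big1// => x _; rewrite ffunE.
move=> a u v; rewrite !inE => /eqP u0 /eqP v0.
under eq_bigr do rewrite !ffunE.
by rewrite big_split/= -mulr_sumr u0 v0 mulr0 addr0.
Qed.

HB.instance Definition _ :=
  GRing.isSubmodClosed.Build R {ffun X -> R^o} zero_sum zero_sum_submod.

Record LF := MkLF { LF_fun :> {ffun X -> R^o}; _ : LF_fun \in zero_sum }.

HB.instance Definition _ := [isSub for LF_fun].
HB.instance Definition _ := [Choice of LF by <:].
HB.instance Definition _ := [SubChoice_isSubLmodule of LF by <:].

Definition indic1 p : {ffun X -> R^o} := [ffun x => (x == p)%:R].

Definition LF_costs mu : set R :=
  [set s | exists (r : nat) (a : 'I_r -> R) (p q : 'I_r -> X),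
     mu = \sum_(j < r) a j *: (indic1 (p j) - indic1 (q j)) /\
     s = \sum_(j < r) `|a j| * mdist (p j) (q j)].

Definition LF_norm (mu : LF) : R := inf (LF_costs mu).

Lemma LF_costs_ge0 mu : lbound (LF_costs mu) 0.
Proof.
move=> _ [r [a [p [q [_ ->]]]]].
by apply: sumr_ge0 => j _; rewrite mulr_ge0// mdist_ge0.
Qed.

Lemma LF_costs_nonempty (mu : LF) : LF_costs mu !=set0.
Proof.
have [x0 _|X0] := pickP (fun _ : X => true); last first.
  have f : 'I_0 -> X by case.
  exists 0, 0%N, (fun=> 0), f, f; split.
    by apply/ffunP => x; have := X0 x.
  by rewrite big_ord0.
pose a (j : 'I_#|X|) : R := mu (enum_val j).
exists (\sum_(j < #|X|) `|a j| * mdist (enum_val j) x0).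
exists #|X|, a, enum_val, (fun=> x0); split => //.
have mu0 : \sum_x mu x = 0 by apply/eqP; exact: (valP mu).
apply/ffunP => x; rewrite sum_ffunE.
rewrite -(big_enum_val (fun y => (mu y *: (indic1 y - indic1 x0)) x))/=.
under eq_bigr => y _ do rewrite !ffunE /GRing.scale/= mulrBr.
rewrite sumrB -[X in _ = _ - X]mulr_suml mu0 mul0r subr0.
rewrite (bigD1 x)//= eqxx mulr1 big1 ?addr0// => y /negbTE.
by rewrite eq_sym => ->; rewrite mulr0.
Qed.

Lemma LF_costs_has_inf (mu : LF) : has_inf (LF_costs mu).
Proof. by split; [exact: LF_costs_nonempty|exists 0; exact: LF_costs_ge0]. Qed.

Lemma LF_costsD mu nu s t :
  LF_costs mu s -> LF_costs nu t -> LF_costs (mu + nu) (s + t).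
Proof.
move=> [r [a [p [q [-> ->]]]]] [r' [a' [p' [q' [-> ->]]]]].
pose g T (u : 'I_r -> T) (v : 'I_r' -> T) (i : 'I_(r + r')) : T :=
  match fintype.split i with inl j => u j | inr j => v j end.
have gl T u v j : @g T u v (lshift r' j) = u j.
  by rewrite /g -[lshift r' j]/(unsplit (inl j)) unsplitK.
have gr T u v j : @g T u v (rshift r j) = v j.
  by rewrite /g -[rshift r j]/(unsplit (inr j)) unsplitK.
exists (r + r')%N, (g _ a a'), (g _ p p'), (g _ q q').
by split; rewrite big_split_ord/=; congr (_ + _); apply: eq_bigr => j _;
  rewrite ?gl ?gr.
Qed.

Lemma LF_costsZ l mu s : LF_costs mu s -> LF_costs (l *: mu) (`|l| * s).
Proof.
move=> [r [a [p [q [-> ->]]]]].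
exists r, (fun j => l * a j), p, q; split.
  by rewrite scaler_sumr; apply: eq_bigr => j _; rewrite scalerA.
by rewrite mulr_sumr; apply: eq_bigr => j _; rewrite normrM mulrA.
Qed.

Lemma LF_norm_ge0 (mu : LF) : 0 <= LF_norm mu.
Proof.
by apply: lb_le_inf; [exact: LF_costs_nonempty|exact: LF_costs_ge0].
Qed.

Lemma LF_normD (mu nu : LF) : LF_norm (mu + nu) <= LF_norm mu + LF_norm nu.
Proof.
apply/ler_addgt0Pr => e e0; have e20 : 0 < e / 2 by rewrite divr_gt0.
have [s ms sle] := inf_adherent e20 (LF_costs_has_inf mu).
have [t mt tle] := inf_adherent e20 (LF_costs_has_inf nu).
have le_st : LF_norm (mu + nu) <= s + t.
  by apply: ge_inf; [exists 0; exact: LF_costs_ge0|exact: LF_costsD].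
by rewrite /LF_norm in le_st *; lra.
Qed.

Lemma LF_normZ_le l (mu : LF) : LF_norm (l *: mu) <= `|l| * LF_norm mu.
Proof.
have [->|l0] := eqVneq l 0.
  rewrite normr0 mul0r; apply: ge_inf; first by exists 0; exact: LF_costs_ge0.
  have [s ms] := LF_costs_nonempty mu.
  by have := LF_costsZ 0 ms; rewrite normr0 mul0r.
rewrite -ler_pdivrMl ?normr_gt0//; apply: lb_le_inf.
  exact: LF_costs_nonempty.
move=> s ms; rewrite ler_pdivrMl ?normr_gt0//; apply: ge_inf.
  by exists 0; exact: LF_costs_ge0.
exact: LF_costsZ.
Qed.

Lemma LF_normZ l (mu : LF) : LF_norm (l *: mu) = `|l| * LF_norm mu.
Proof.
apply/eqP; rewrite eq_le LF_normZ_le/=.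
have [->|l0] := eqVneq l 0; first by rewrite normr0 mul0r LF_norm_ge0.
rewrite -ler_pdivlMl ?normr_gt0// -normfV.
by rewrite -{1}[mu]scale1r -(mulVf l0) -scalerA LF_normZ_le.
Qed.

Lemma mdist_separated x :
  exists2 e : R, 0 < e & forall y, y != x -> e <= mdist x y.
Proof.
exists (\big[Num.min/1]_(y | y != x) mdist x y).
  apply: (big_ind (fun u : R => 0 < u)) => // [u v u0 v0|y yx].
    by rewrite lt_min u0 v0.
  by rewrite mdist_gt0 eq_sym.
by move=> y yx; rewrite (bigD1 y)//= ge_min lexx.
Qed.

Lemma LF_norm0_eq0 (mu : LF) : LF_norm mu = 0 -> mu = 0.
Proof.
move=> mu0; apply/val_inj/ffunP => x; rewrite [RHS]ffunE.
have [e e0 ed] := mdist_separated x.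
suff : e * `|mu x| <= LF_norm mu.
  by rewrite mu0 pmulr_rle0// normr_le0 => /eqP.
apply: lb_le_inf; first exact: LF_costs_nonempty.
move=> _ [r [a [p [q [-> ->]]]]]; rewrite sum_ffunE mulrC.
rewrite (le_trans (ler_wpM2r (ltW e0) (ler_norm_sum _ _ _)))// mulr_suml.
apply: ler_sum => j _; rewrite !ffunE /GRing.scale/= normrM -mulrA.
apply: ler_wpM2l => //.
have [xp|xp] := eqVneq x (p j); have [xq|xq] := eqVneq x (q j);
  rewrite ?subrr ?subr0 ?sub0r ?normrN ?normr0 ?normr1 ?mul0r ?mul1r
    ?mdist_ge0//.
- by rewrite -xp ed// eq_sym.
- by rewrite -xq metric_sym ed// eq_sym.
Qed.

HB.instance Definition _ :=
  Lmodule_isNormed.Build R LF LF_normD LF_normZ LF_norm0_eq0.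

End LipschitzFree.

Arguments LF {R} X.

(* An alias of ['rV[R]_m], on which the library already puts the sup norm. *)
Definition ell1 (R : realType) (m : nat) : Type := 'rV[R]_m.

Section Ell1.
Variables (R : realType) (m : nat).

HB.instance Definition _ := GRing.Lmodule.copy (ell1 R m) 'rV[R]_m.

Definition ell1_norm (v : ell1 R m) : R := \sum_(i < m) `|v ord0 i|.

Lemma ell1_normD (u v : ell1 R m) :
  ell1_norm (u + v) <= ell1_norm u + ell1_norm v.
Proof.
rewrite /ell1_norm -big_split/=; apply: ler_sum => i _.
by rewrite [X in `|X|]mxE ler_normD.
Qed.

Lemma ell1_normZ (l : R) (v : ell1 R m) :
  ell1_norm (l *: v) = `|l| * ell1_norm v.
Proof.
by rewrite /ell1_norm mulr_sumr; apply: eq_bigr => i _; rewrite mxE normrM.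
Qed.

Lemma ell1_norm0_eq0 (v : ell1 R m) : ell1_norm v = 0 -> v = 0.
Proof.
move=> /psumr_eq0P v0; apply/rowP => i.
by rewrite [RHS]mxE; apply/normr0_eq0/v0.
Qed.

HB.instance Definition _ :=
  Lmodule_isNormed.Build R (ell1 R m) ell1_normD ell1_normZ ell1_norm0_eq0.

End Ell1.

Section BanachMazur.
Variables (R : realType).

(* Extended-real valued, so that an unbounded map has norm [+oo]. *)
Definition op_norm (E F : normedModType R) (A : set E) (f : E -> F) : \bar R :=
  ereal_sup [set `|f x|%:E | x in A `&` [set x | `|x| <= 1]].

(* [S] is T^-1 on [range T]; its values elsewhere are irrelevant.  The case
   0 * +oo = 0 of the product cannot occur: [T] is injective, so if one factor
   is 0 then [E] is trivial and so is the other. *)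
Definition embeds_with_distortion (E F : normedModType R) (D : R) : Prop :=
  exists (T : {linear E -> F}) (S : F -> E),
    cancel T S /\ (op_norm setT T * op_norm (range T) S <= D%:E)%E.

End BanachMazur.

(* Main.v *)
Require Import Defs.
From HB Require Import structures.
From mathcomp Require Import all_boot all_order all_algebra all_fingroup.
From mathcomp Require Import all_classical all_reals all_analysis.
From mathcomp Require Import ring lra.
Set Implicit Arguments.
Unset Strict Implicit.
Unset Printing Implicit Defensive.
Import Order.TTheory GRing.Theory Num.Theory.
Import numFieldNormedType.Exports.
Local Open Scope ring_scope.

(** Random hierarchical partitions (Fakcharoenphol-Rao-Talwar) give a probability
on trees that dominate the metric of [X] and stretch each distance by
[O(log n)] on average.  The free space of a tree is isometric to an [l1] space
whose coordinates are the weighted masses of the clusters, so averaging gives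
weights [W] on the subsets of [X] such that [\sum_C W C * |mu(C)|] is
equivalent to the norm of [mu] up to [O(log n)].  Caratheodory's theorem,
applied to the vector of all stretches, leaves only polynomially many sets [C].

It remains to embed an [n]-dimensional space, given by [N = n^O(1)] rows [a_i]
of an [l1] norm, into [l1^m] with [m = O(n log N)], up to a constant factor.
After splitting rows so that all Lewis weights are [O(n / N)], some choice of
signs makes [\sum_i e_i |a_i x|] at most [O(sqrt (n log N / N))] times the norm
of [x]: the contraction principle removes the absolute values, and a union bound
over the rows controls the remaining linear process.  Keeping the rows of one
sign halves their number, and the errors of the successive halvings sum
geometrically. *)

(** * Lewis weights *)

Section Dot.
Variables (R : realType) (d : nat).
Implicit Types u v x y : 'cV[R]_d.

Definition dot u v : R := (u^T *m v) 0 0.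

Lemma dotC u v : dot u v = dot v u.
Proof. by rewrite /dot -[u^T *m v]trmxK mxE trmx_mul trmxK. Qed.

Lemma dotE u v : dot u v = \sum_k u k 0 * v k 0.
Proof. by rewrite /dot mxE; apply: eq_bigr => k _; rewrite mxE. Qed.

Lemma dotDr u v x : dot u (v + x) = dot u v + dot u x.
Proof. by rewrite /dot mulmxDr mxE. Qed.

Lemma dotZr c u v : dot u (c *: v) = c * dot u v.
Proof. by rewrite /dot -scalemxAr mxE. Qed.

Lemma dotZl c u v : dot (c *: u) v = c * dot u v.
Proof. by rewrite dotC dotZr dotC. Qed.

Lemma dotBr u v x : dot u (v - x) = dot u v - dot u x.
Proof. by rewrite dotDr -scaleN1r dotZr mulN1r. Qed.

Lemma dot0r u : dot u 0 = 0.
Proof. by rewrite /dot mulmx0 mxE. Qed.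

Lemma dot_sumr (J : Type) (r : seq J) (P : pred J) u (F : J -> 'cV[R]_d) :
  dot u (\sum_(j <- r | P j) F j) = \sum_(j <- r | P j) dot u (F j).
Proof. exact: (big_morph (dot u) (dotDr u) (dot0r u)). Qed.

Lemma dot_mull (M : 'M[R]_d) u v : dot (M *m u) v = dot u (M^T *m v).
Proof. by rewrite /dot trmx_mul mulmxA. Qed.

End Dot.

Section LewisWeights.
Variables (R : realType) (d : nat) (I : finType) (a : I -> 'cV[R]_d).
Implicit Types (w : I -> R) (x y u : 'cV[R]_d).

(** Stated as triviality of the common kernel, which is what makes [gram w] invertible for positive
    [w]. *)
Definition spanning := forall x, (forall i, dot (a i) x = 0) -> x = 0.

Definition gram w : 'M[R]_d := \sum_i (w i)^-1 *: (a i *m (a i)^T).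

Lemma tr_gram w : (gram w)^T = gram w.
Proof.
rewrite /gram linear_sum/=; apply: eq_bigr => i _.
by rewrite linearZ/= trmx_mul trmxK.
Qed.

Lemma gram_mul w y : gram w *m y = \sum_i ((w i)^-1 * dot (a i) y) *: a i.
Proof.
rewrite /gram mulmx_suml; apply: eq_bigr => i _.
rewrite -scalemxAl -mulmxA -scalerA; congr (_ *: _).
by apply/colP => k; rewrite mxE big_ord1 [in RHS]mxE /dot mulrC.
Qed.

Lemma dot_gram w x y :
  dot x (gram w *m y) = \sum_i (w i)^-1 * dot (a i) x * dot (a i) y.
Proof.
rewrite gram_mul dot_sumr; apply: eq_bigr => i _.
by rewrite dotZr (dotC x) mulrAC.
Qed.

Hypothesis spa : spanning.

Lemma gram_unit w : (forall i, 0 < w i) -> gram w \in unitmx.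
Proof.
move=> w0; rewrite -row_free_unit; apply: inj_row_free => v vG.
apply: trmx_inj; rewrite trmx0; apply: spa => i.
have Gv0 : gram w *m v^T = 0 by rewrite -[gram w]tr_gram -trmx_mul vG trmx0.
have := dot_gram w v^T v^T; rewrite Gv0 dot0r => /esym/eqP.
rewrite psumr_eq0; last first.
  by move=> j _; rewrite -mulrA mulr_ge0 ?invr_ge0 ?(ltW (w0 j))// -expr2 sqr_ge0.
move=> /allP/(_ i); rewrite mem_index_enum => /(_ isT)/=.
by rewrite -mulrA mulf_eq0 invr_eq0 gt_eqF//= -expr2 sqrf_eq0 => /eqP.
Qed.

(** [tau w (a i) / w i] is the leverage score of [a i] scaled by [1 / sqrt (w i)]; the l1 Lewis
    weights are the positive solutions of [tau w (a i) = w i ^+ 2]. *)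
Definition tau w u : R := dot u (invmx (gram w) *m u).

Lemma tauE w u : (forall i, 0 < w i) ->
  tau w u = \sum_i (w i)^-1 * dot (a i) (invmx (gram w) *m u) ^+ 2.
Proof.
move=> w0; rewrite /tau -{1}[u](mulKVmx (gram_unit w0)) dot_mull tr_gram.
by rewrite dot_gram; apply: eq_bigr => i _; rewrite -mulrA expr2.
Qed.

Lemma tau_gt0 w u : (forall i, 0 < w i) -> u != 0 -> 0 < tau w u.
Proof.
move=> w0 u0; rewrite lt0r andbC tauE// sumr_ge0/=; last first.
  by move=> i _; rewrite mulr_ge0 ?invr_ge0 ?(ltW (w0 i))// sqr_ge0.
apply: contra u0; rewrite psumr_eq0 => [/allP q0|i _]; last first.
  by rewrite mulr_ge0 ?invr_ge0 ?(ltW (w0 i))// sqr_ge0.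
rewrite -[u](mulKVmx (gram_unit w0)) (_ : invmx _ *m u = 0) ?mulmx0//.
apply: spa => i; have := q0 i; rewrite mem_index_enum => /(_ isT)/=.
by rewrite mulf_eq0 invr_eq0 gt_eqF//= sqrf_eq0 => /eqP.
Qed.

(* Completing the square in the quadratic form of [gram w'] at
   [y - c z], where [y], [z] are the images of [u] under the two inverses. *)
Lemma tau_le w w' c u : (forall i, 0 < w i) -> (forall i, 0 < w' i) ->
  (forall i, w i <= c * w' i) -> 0 < c -> tau w u <= c * tau w' u.
Proof.
move=> w0 w'0 ww' c0.
pose y := invmx (gram w) *m u; pose z := invmx (gram w') *m u.
have q'y : \sum_i (w' i)^-1 * dot (a i) y ^+ 2 <= c * tau w u.
  rewrite tauE// mulr_sumr; apply: ler_sum => i _; rewrite [leRHS]mulrA.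
  apply: ler_wpM2r; first exact: sqr_ge0.
  by rewrite ler_pdivlMr// mulrC ler_pdivrMr// mulrC.
have cross : \sum_i (w' i)^-1 * dot (a i) z * dot (a i) y = tau w u.
  rewrite -dot_gram dotC dot_mull tr_gram dotC /z mulKVmx// ?gram_unit//.
have q'z : \sum_i (w' i)^-1 * dot (a i) z ^+ 2 = tau w' u by rewrite tauE.
have : 0 <= \sum_i (w' i)^-1 * dot (a i) (y - c *: z) ^+ 2.
  by apply: sumr_ge0 => i _; rewrite mulr_ge0 ?invr_ge0 ?(ltW (w'0 i))// sqr_ge0.
have -> : \sum_i (w' i)^-1 * dot (a i) (y - c *: z) ^+ 2 =
    \sum_i (w' i)^-1 * dot (a i) y ^+ 2
    - 2 * c * \sum_i (w' i)^-1 * dot (a i) z * dot (a i) y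
    + c ^+ 2 * \sum_i (w' i)^-1 * dot (a i) z ^+ 2.
  rewrite !mulr_sumr -sumrB -big_split/=; apply: eq_bigr => i _.
  by rewrite dotBr dotZr; ring.
rewrite cross q'z => h.
rewrite -(ler_pM2l c0); move: q'y h; set s := \sum_i _; nra.
Qed.

(** The sum is the trace of [invmx (gram w) *m gram w], the identity matrix of size [d]. *)
Lemma sum_leverage w : (forall i, 0 < w i) ->
  \sum_i tau w (a i) / w i = d%:R.
Proof.
move=> w0; rewrite -mxtrace1 -(mulVmx (gram_unit w0)).
rewrite {2}/gram mulmx_sumr linear_sum/=; apply: eq_bigr => i _.
rewrite -scalemxAr mxtraceZ mulmxA mxtrace_mulC /tau /dot mulrC.
by rewrite trace_mx11.
Qed.

Hypothesis a_neq0 : forall i, a i != 0.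

Let lewis_map w i := Num.sqrt (tau w (a i)).

Let lewis_map_gt0 w : (forall i, 0 < w i) -> forall i, 0 < lewis_map w i.
Proof. by move=> w0 i; rewrite sqrtr_gt0 tau_gt0. Qed.

Let lewis_map_le w w' c : (forall i, 0 < w i) -> (forall i, 0 < w' i) ->
  (forall i, w i <= c * w' i) -> 0 < c ->
  forall i, lewis_map w i <= Num.sqrt c * lewis_map w' i.
Proof.
move=> w0 w'0 ww' c0 i; rewrite -sqrtrM ?(ltW c0)//.
by apply: ler_wsqrtr; exact: tau_le.
Qed.

(* [lewis_map] halves distances in the sup metric of [ln \o w], so iterating it
   brings any [w] within a factor 2 of its image. *)
Let lewis_iter k : forall w c, (forall i, 0 < w i) -> 0 < c ->
  c <= 2 ^+ (2 ^ k) -> (forall i, w i <= c * lewis_map w i) ->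
  (forall i, lewis_map w i <= c * w i) ->
  exists2 v, forall i, 0 < v i &
    (forall i, v i <= 2 * lewis_map v i) /\ forall i, lewis_map v i <= 2 * v i.
Proof.
elim: k => [|k IHk] w c w0 c0 ck wm mw.
  have c2 : c <= 2 by rewrite -[2]expr1.
  exists w => //; split=> i.
    by rewrite (le_trans (wm i))// ler_wpM2r// ltW// lewis_map_gt0.
  by rewrite (le_trans (mw i))// ler_wpM2r// ltW.
have m0 := lewis_map_gt0 w0.
apply: (IHk (lewis_map w) (Num.sqrt c)) => //.
- by rewrite sqrtr_gt0.
- have -> : 2 ^+ (2 ^ k) = Num.sqrt (2 ^+ (2 ^ k.+1)) :> R.
    by rewrite expnS mulnC exprM sqrtr_sqr ger0_norm// exprn_ge0.
  exact: ler_wsqrtr.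
- exact: lewis_map_le.
- exact: lewis_map_le.
Qed.

(** Fixing [w] under [lewis_map] up to a factor 2 is enough: both bounds lose the square of that
    factor, and [sum_leverage] gives the total. *)
Lemma lewis_weights : exists2 w, forall i, 0 < w i &
  (forall i, tau w (a i) <= 4 * w i ^+ 2) /\ \sum_i w i <= 4 * d%:R.
Proof.
pose w1 (i : I) : R := 1.
have w10 i : 0 < w1 i by rewrite /w1.
have m0 := lewis_map_gt0 w10.
(* A crude bound on the ratio, in both directions, between the constant weight 1 and its image; its
   size is harmless, since each iteration replaces it by its square root. *)
pose c := 1 + \sum_i (lewis_map w1 i + (lewis_map w1 i)^-1).
have sum0 (P : pred I) :
    0 <= \sum_(i | P i) (lewis_map w1 i + (lewis_map w1 i)^-1).
  by apply: sumr_ge0 => i _; rewrite addr_ge0 ?invr_ge0 ?(ltW (m0 i)).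
have c1 i : lewis_map w1 i <= c /\ (lewis_map w1 i)^-1 <= c.
  have := sum0 (fun j => j != i); set s := \sum_(_ | _) _ => s0.
  rewrite /c (bigD1 i)//= -/s; move: s0 (m0 i).
  have : 0 < (lewis_map w1 i)^-1 by rewrite invr_gt0.
  by lra.
have c0 : 0 < c by have := sum0 xpredT; rewrite /c; set s := \sum_i _; lra.
have [k ck] : exists k, c <= 2 ^+ (2 ^ k).
  exists (Num.truncn c).+1; apply: (le_trans (ltW (truncnS_gt c))).
  rewrite -natrX ler_nat.
  exact: leq_trans (ltnW (ltn_expl _ _)) (ltnW (ltn_expl _ _)).
have [i|i|w w0 [wm mw]] := lewis_iter w10 c0 ck.
- by rewrite -ler_pdivrMr// mul1r; case: (c1 i).
- by rewrite mulr1; case: (c1 i).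
have tw i : lewis_map w i ^+ 2 = tau w (a i).
  by rewrite sqr_sqrtr// ltW// tau_gt0.
exists w => //; split=> [i|].
  have := mw i; have := lewis_map_gt0 w0 i; have := w0 i.
  rewrite -tw; set s := lewis_map w i; nra.
rewrite -(sum_leverage w0) mulr_sumr; apply: ler_sum => i _.
rewrite mulrA ler_pdivlMr// -tw.
rewrite (_ : 4 * _ = (2 * lewis_map w i) ^+ 2); last by ring.
by rewrite -expr2 lerXn2r// nnegrE ?ltW// mulr_gt0// lewis_map_gt0.
Qed.

End LewisWeights.

(** * Sparsification of l1 norms *)

Section Contraction.
Variables (R : realType) (J : finType) (T : Type) (A : set T) (B : R).
Hypothesis A0 : (A !=set0)%classic.
Implicit Types (e : {ffun J -> bool}) (f g : J -> T -> R).

Definition signed_sum f e t : R := \sum_j (-1) ^+ e j * f j t.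

Definition sup_signed f e : R := sup (signed_sum f e @` A)%classic.

Let bounded f := forall j t, A t -> `|f j t| <= B.

Lemma le_sup_signed f e t : bounded f -> A t ->
  signed_sum f e t <= sup_signed f e.
Proof.
move=> fB At; apply: ub_le_sup; last by exists t.
exists (\sum_(j : J) B) => _ [s As <-]; apply: ler_sum => j _.
by rewrite (le_trans (ler_norm _))// normrM normrX normrN1 expr1n mul1r fB.
Qed.

Lemma sup_signed_le f e c : (forall t, A t -> signed_sum f e t <= c) ->
  sup_signed f e <= c.
Proof.
move=> fc; apply: ge_sup; last by move=> _ [t At <-]; exact: fc.
by case: A0 => t At; exists (signed_sum f e t), t.
Qed.

Let flip k e : {ffun J -> bool} := [ffun j => e j (+) (j == k)].

Let flipK k : involutive (flip k).
Proof. by move=> e; apply/ffunP => j; rewrite !ffunE addbK. Qed.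

(* Pairing each sign vector with its flip at [k] leaves only the sign in
   position [k] free, where the triangle inequality applies. *)
Let contraction_step f g k : bounded f -> bounded g ->
  (forall j, j != k -> f j = g j) ->
  (forall s t, A s -> A t -> `|f k s - f k t| <= `|g k s - g k t|) ->
  \sum_e sup_signed f e <= \sum_e sup_signed g e.
Proof.
move=> fB gB fg fgk.
have dup h : 2 * \sum_e sup_signed h e =
    \sum_e (sup_signed h e + sup_signed h (flip k e)).
  rewrite big_split/= mulr2n mulrDl mul1r; congr (_ + _).
  by rewrite (reindex_inj (inv_inj (flipK k))).
rewrite -(ler_pM2l (ltr0Sn _ 1)) !dup; apply: ler_sum => e _.
pose r t := \sum_(j | j != k) (-1) ^+ e j * g j t.
have split_k h t : (forall j, j != k -> h j = g j) ->
    signed_sum h e t = r t + (-1) ^+ e k * h k t.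
  move=> hg; rewrite /signed_sum (bigD1 k)//= addrC; congr (_ + _).
  by apply: eq_bigr => j jk; rewrite hg.
have split_flip h t : (forall j, j != k -> h j = g j) ->
    signed_sum h (flip k e) t = r t - (-1) ^+ e k * h k t.
  move=> hg; rewrite /signed_sum (bigD1 k)//= addrC ffunE eqxx addbT.
  rewrite -mulNr -signrN; congr (_ + _).
  by apply: eq_bigr => j jk; rewrite ffunE (negbTE jk) addbF hg.
(* Both suprema are tested at arbitrary points [s] and [t]. The resulting [|g k s - g k t|] is
   realized by [g] either at these points or with [s] and [t] exchanged, hence the four instances of
   [le_sup_signed]. *)
rewrite -lerBrDr; apply: sup_signed_le => s As.
rewrite lerBrDr -lerBrDl; apply: sup_signed_le => t At.
rewrite lerBrDl !(split_k, split_flip)//.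
have := fgk s t As At.
have := le_sup_signed e gB As; have := le_sup_signed e gB At.
have := le_sup_signed (flip k e) gB As; have := le_sup_signed (flip k e) gB At.
rewrite !(split_k, split_flip)//.
move: (f k s) (f k t) (g k s) (g k t) => fs ft gs gt.
case: (e k); rewrite ?(expr0, expr1) => h1 h2 h3 h4;
  rewrite ler_norml => /andP[]; have [|] := leP 0 (gs - gt);
  [move=> p; rewrite (ger0_norm p)|move=> p; rewrite (ltr0_norm p)
  |move=> p; rewrite (ger0_norm p)|move=> p; rewrite (ltr0_norm p)]; lra.
Qed.

Lemma contraction f g : bounded f -> bounded g ->
  (forall j s t, A s -> A t -> `|f j s - f j t| <= `|g j s - g j t|) ->
  \sum_e sup_signed f e <= \sum_e sup_signed g e.
Proof.
move=> fB gB fg.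
(* Hybrid families: the indices in [s] have already been switched from [f] to [g], so each step
   changes a single index. *)
pose h (s : seq J) j := if j \in s then g j else f j.
have hB s : bounded (h s) by move=> j t At; rewrite /h; case: ifP => _; auto.
suff H s : \sum_e sup_signed f e <= \sum_e sup_signed (h s) e.
  have := H (enum J); rewrite (_ : h (enum J) = g)//.
  by apply/funext => j; rewrite /h mem_enum.
elim: s => [|k s IHs]; first by rewrite (_ : h [::] = f)//; apply/funext.
apply: (le_trans IHs); apply: (@contraction_step _ _ k) => // [j jk|s' t As At].
  by rewrite /h in_cons (negbTE jk).
by rewrite /h in_cons eqxx/=; case: ifP => // _; exact: fg.
Qed.

End Contraction.

(** * Exponential moments of signed sums *)

Section Subgaussian.
Variable R : realType.

Lemma expR_le_inv (y : R) : y < 1 -> expR y <= (1 - y)^-1.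
Proof.
move=> y1; rewrite -[y in leLHS]opprK expRN.
by rewrite lef_pV2 ?posrE ?expR_gt0 ?expR_ge1Dx// subr_gt0.
Qed.

(** The generous exponent allows an elementary proof: for [x > 1/2] one has [x <= 2 * x ^+ 2], and
    for smaller [x] the geometric bounds add up to [2 / (1 - x ^+ 2)], at most
    [2 * (1 + 2 * x ^+ 2)]. *)
Lemma coshR_le (x : R) : expR x + expR (- x) <= 2 * expR (2 * x ^+ 2).
Proof.
wlog x0 : x / 0 <= x.
  move=> wl; have [/wl//|/ltW x0] := leP 0 x.
  by have := wl (- x); rewrite opprK sqrrN addrC oppr_ge0; apply.
have [xl|xg] := leP x 2^-1; last first.
  have x2 : x <= 2 * x ^+ 2 by nra.
  rewrite mulr2n mulrDl mul1r lerD// ler_expR//.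
  by rewrite (le_trans _ x2)// (le_trans _ x0)// oppr_le0.
have b1 : expR x <= (1 - x)^-1 by apply: expR_le_inv; lra.
have b2 : expR (- x) <= (1 + x)^-1.
  by rewrite -[X in (1 + X)^-1]opprK; apply: expR_le_inv; lra.
apply: (le_trans (lerD b1 b2)).
have := expR_ge1Dx (2 * x ^+ 2).
have -> : (1 - x)^-1 + (1 + x)^-1 = 2 / (1 - x ^+ 2).
  by field; apply/and3P; split; rewrite gt_eqF//; nra.
move=> h; apply: ler_wpM2l => //; apply: (le_trans _ h).
have x4 : x ^+ 2 <= 4^-1 by nra.
rewrite -[leLHS]mul1r ler_pdivrMr; last by lra.
move: (sqr_ge0 x) x4; set y := x ^+ 2; nra.
Qed.

Variable J : finType.
Implicit Types (e : {ffun J -> bool}) (c : J -> R).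

(** Independence of the signs: the sum over sign vectors of a product is a product over [j] of
    two-term sums, each bounded by [coshR_le]. *)
Lemma sum_expR_signed c :
  \sum_(e : {ffun J -> bool}) expR (\sum_j (-1) ^+ e j * c j)
    <= 2 ^+ #|J| * expR (2 * \sum_j c j ^+ 2).
Proof.
under eq_bigr do rewrite expR_sum.
rewrite -(bigA_distr_bigA (fun j (b : bool) => expR ((-1) ^+ b * c j))).
rewrite mulr_sumr expR_sum -prodr_const -big_split/=.
apply: ler_prod => j _; rewrite big_bool/= expr1 expr0 mulN1r mul1r addrC.
by rewrite addr_ge0 ?expR_ge0//= coshR_le.
Qed.

(* [z <= a - 1 + expR (z - a)] replaces Jensen's inequality. *)
Lemma maximal_inequality (K : finType) (c : J -> K -> R) (s l lam : R)
    (f : {ffun J -> bool} -> R) :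
  (0 < #|K|)%N -> 0 < lam -> ln (2 * #|K|%:R) <= l ->
  (forall k, \sum_j c j k ^+ 2 <= s) ->
  (forall e M, (forall k, `|\sum_j (-1) ^+ e j * c j k| <= M) -> f e <= M) ->
  \sum_e f e <= 2 ^+ #|J| * (l / lam + 2 * lam * s).
Proof.
move=> K0 lam0 lK cs fM; pose X e k := \sum_j (-1) ^+ e j * c j k.
(* [expR a] bounds the average over [e] of the sum of exponentials in [U e], so [U] averages to at
   most [a / lam]. *)
pose a := l + 2 * lam ^+ 2 * s.
pose U e := (a - 1 + expR (- a) *
  \sum_k (expR (lam * X e k) + expR (- (lam * X e k)))) / lam.
have fU e : f e <= U e.
  apply: fM => k; rewrite -/(X e k) /U ler_pdivlMr// mulrC.
  have le_z z : z <= a - 1 + expR (- a) * expR z.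
    by rewrite -expRD; have := expR_ge1Dx (- a + z); lra.
  rewrite (_ : lam * `|X e k| = `|lam * X e k|); last first.
    by rewrite normrM gtr0_norm.
  apply: (le_trans (le_z _)); rewrite lerD2l ler_wpM2l ?expR_ge0//.
  rewrite (bigD1 k)//= -[leLHS]addr0 lerD//; last first.
    by apply: sumr_ge0 => i _; rewrite addr_ge0 ?expR_ge0.
  by case: ger0P => _; rewrite ?lerDl ?lerDr expR_ge0.
apply: (le_trans (ler_sum _ (fun e _ => fU e))).
have mgf k (t : R) : t ^+ 2 = lam ^+ 2 ->
    \sum_(e : {ffun J -> bool}) expR (t * X e k) <=
      2 ^+ #|J| * expR (2 * lam ^+ 2 * s).
  move=> tl; under eq_bigr => e _.
    rewrite /X mulr_sumr; under eq_bigr do rewrite mulrCA.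
    over.
  apply: (le_trans (sum_expR_signed (fun j => t * c j k))).
  rewrite ler_wpM2l ?exprn_ge0// ler_expR -mulrA ler_wpM2l//.
  under eq_bigr do rewrite exprMn tl.
  by rewrite -mulr_sumr ler_wpM2l ?sqr_ge0.
rewrite -mulr_suml ler_pdivrMr// -[leRHS]mulrA mulrDl divfK ?gt_eqF//.
rewrite big_split/= sumr_const card_ffun card_bool -mulr_sumr exchange_big/=.
have sumK : \sum_k \sum_(e : {ffun J -> bool})
      (expR (lam * X e k) + expR (- (lam * X e k)))
    <= 2 ^+ #|J| * expR a.
  apply: (@le_trans _ _
    (\sum_(k : K) 2 * (2 ^+ #|J| * expR (2 * lam ^+ 2 * s)))).
    apply: ler_sum => k _; rewrite big_split/= mulr2n mulrDl mul1r lerD ?mgf//.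
    by under eq_bigr do rewrite -mulNr; rewrite mgf// sqrrN.
  rewrite sumr_const -[_ *+ #|_|]mulr_natr.
  rewrite (_ : _ * _ = 2 ^+ #|J| * (2 * #|K|%:R * expR (2 * lam ^+ 2 * s)));
    last by ring.
  rewrite ler_wpM2l ?exprn_ge0// /a expRD ler_wpM2r ?expR_ge0//.
  by rewrite -ler_ln ?posrE ?expR_gt0 ?expRK// mulr_gt0// ltr0n.
have -> : 2 * lam * s * lam = 2 * lam ^+ 2 * s by ring.
rewrite -/a -[_ *+ (2 ^ _)]mulr_natl natrX.
apply: (@le_trans _ _ (2 ^+ #|J| * (a - 1) + expR (- a) * (2 ^+ #|J| * expR a))).
  by rewrite lerD2l ler_wpM2l ?expR_ge0.
rewrite mulrCA -expRD addNr expR0 -mulrDr.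
by rewrite subrK.
Qed.

End Subgaussian.

(** * Repeated halving of the rows *)

Section Sparsification.
Variables (R : realType) (d : nat).

Definition l1 (I : finType) (a : I -> 'cV[R]_d) (x : 'cV[R]_d) : R :=
  \sum_i `|dot (a i) x|.

Lemma l1_ge0 (I : finType) (a : I -> 'cV[R]_d) x : 0 <= l1 a x.
Proof. exact: sumr_ge0. Qed.

Lemma le_l1 (I : finType) (a : I -> 'cV[R]_d) x i : `|dot (a i) x| <= l1 a x.
Proof. by rewrite /l1 (bigD1 i)//= lerDl sumr_ge0. Qed.

(* Writing [x = H G x], with [G] the weighted Gram matrix and [H] its inverse,
   expresses a signed sum of the [dot (b j) x] as a combination, with
   coefficients again [dot (b k) x], of subgaussian variables independent
   of [x]. *)
Lemma exists_signs (J : finType) (b : J -> 'cV[R]_d) (v : J -> R) eta lam l :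
  spanning b -> (forall j, 0 < v j) -> (forall j, v j <= eta) ->
  (forall j, tau b v (b j) <= 4 * v j ^+ 2) ->
  (0 < #|J|)%N -> 0 < lam -> ln (2 * #|J|%:R) <= l ->
  exists e : {ffun J -> bool}, forall x,
    `|\sum_j (-1) ^+ e j * `|dot (b j) x| | <=
      2 * (l / lam + 8 * lam * eta) * l1 b x.
Proof.
move=> spb v0 veta tauv J0 lam0 lJ.
pose A := [set x | l1 b x <= 1]%classic.
have A00 : A 0.
  by rewrite /A/= /l1 big1// => j _; rewrite dot0r normr0.
have A0 : (A !=set0)%classic by exists 0.
pose f j x := `|dot (b j) x|; pose g j x := dot (b j) x.
have fB j x : A x -> `|f j x| <= 1.
  by move=> Ax; rewrite normr_id (le_trans (le_l1 b x j)).
have gB j x : A x -> `|g j x| <= 1.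
  by move=> Ax; rewrite (le_trans (le_l1 b x j)).
have fg j x y : A x -> A y -> `|f j x - f j y| <= `|g j x - g j y|.
  by move=> _ _; exact: ler_dist_dist.
have := contraction A0 fB gB fg.
(* The variance of the [k]-th signed sum is at most [4 * eta]: bounding [v j] by [eta] compares it
   with [eta * tau b v (b k) / v k ^+ 2], where the Lewis condition cancels [v k ^+ 2]. *)
pose c j k := dot (b j) (invmx (gram b v) *m b k) / v k.
set D := l / lam + 8 * lam * eta.
have gD : \sum_e sup_signed A g e <= 2 ^+ #|J| * D.
  rewrite /D (_ : 8 * lam * eta = 2 * lam * (4 * eta)); last by ring.
  apply: (@maximal_inequality _ _ J c) => // [k|e M XM].
    have vk2 : 0 < v k ^+ 2 by rewrite exprn_gt0.
    rewrite /c; under eq_bigr do rewrite expr_div_n.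
    rewrite -mulr_suml ler_pdivrMr// mulrAC.
    rewrite mulrC; apply: (@le_trans _ _ (eta * tau b v (b k))); last first.
      by rewrite ler_wpM2l//; exact: le_trans (ltW (v0 k)) (veta k).
    rewrite tauE// mulr_sumr; apply: ler_sum => j _; rewrite mulrA.
    rewrite -[leLHS]mul1r ler_wpM2r ?sqr_ge0//.
    by rewrite ler_pdivlMr// mul1r.
  apply: sup_signed_le => // x Ax.
  have [k0 _] : exists k0 : J, true by case/card_gt0P: J0 => k; exists k.
  have M0 : 0 <= M by apply: le_trans (XM k0); rewrite normr_ge0.
  have -> : signed_sum g e x =
      \sum_k dot (b k) x * \sum_j (-1) ^+ e j * c j k.
    under [RHS]eq_bigr do rewrite mulr_sumr; rewrite exchange_big/=.
    apply: eq_bigr => j _.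
    rewrite /g -{1}[x](mulKmx (gram_unit spb v0)) gram_mul mulmx_sumr dot_sumr.
    rewrite mulr_sumr; apply: eq_bigr => k _.
    by rewrite -scalemxAr dotZr /c; ring.
  apply: (le_trans (ler_norm _)); apply: (le_trans (ler_norm_sum _ _ _)).
  rewrite -[leRHS]mul1r; apply: (@le_trans _ _ (l1 b x * M)); last first.
    by rewrite ler_wpM2r.
  by rewrite /l1 mulr_suml; apply: ler_sum => k _; rewrite normrM ler_wpM2l.
move=> /le_trans/(_ gD) fD.
pose neg (e : {ffun J -> bool}) : {ffun J -> bool} := [ffun j => ~~ e j].
have negK : involutive neg by move=> e; apply/ffunP => j; rewrite !ffunE negbK.
(* Averaging over [e]. Opposite sign vectors have opposite signed sums, so controlling both suprema
   controls the absolute value. *)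
have [e eD] : exists e, sup_signed A f e + sup_signed A f (neg e) <= 2 * D.
  apply: contrapT => /forallNP noe.
  have : \sum_(e : {ffun J -> bool}) (2 * D) <
         \sum_e (sup_signed A f e + sup_signed A f (neg e)).
    apply: ltr_sum => [|e _]; last by rewrite ltNge; apply/negP/noe.
    by apply/hasP; exists [ffun=> true]; rewrite ?mem_index_enum.
  rewrite big_split/= -(reindex_inj (inv_inj negK) (P := xpredT)) sumr_const.
  rewrite card_ffun card_bool -[_ *+ (2 ^ _)]mulr_natl natrX.
  by move: fD; set s := \sum_e _; set p := 2 ^+ _; lra.
have sup0 e' : 0 <= sup_signed A f e'.
  apply: le_trans (le_sup_signed e' fB A00).
  by rewrite /signed_sum big1// => j _; rewrite /f dot0r normr0 mulr0.
have bound x : A x -> `|\sum_j (-1) ^+ e j * f j x| <= 2 * D.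
  move=> Ax; have := le_sup_signed e fB Ax; have := le_sup_signed (neg e) fB Ax.
  have -> : signed_sum f (neg e) x = - \sum_j (-1) ^+ e j * f j x.
    rewrite -sumrN; apply: eq_bigr => j _.
    by rewrite ffunE signrN mulNr.
  rewrite /signed_sum ler_norml.
  have := sup0 e; have := sup0 (neg e); move: eD; lra.
exists e => x; have := l1_ge0 b x; rewrite le_eqVlt => /orP[/eqP S0|S0].
  rewrite -S0 mulr0 big1 ?normr0// => j _; apply/eqP.
  by rewrite mulf_eq0 signr_eq0/= -normr_le0 normr_id S0 le_l1.
have Z t : 0 < t -> l1 b (t *: x) = t * l1 b x.
  move=> t0; rewrite /l1 mulr_sumr; apply: eq_bigr => j _.
  by rewrite dotZr normrM gtr0_norm.
have := bound ((l1 b x)^-1 *: x).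
rewrite /A/= Z ?invr_gt0// mulVf ?gt_eqF// lexx => /(_ isT).
under eq_bigr => j _.
  rewrite /f dotZr normrM gtr0_norm ?invr_gt0// mulrCA.
  over.
by rewrite -mulr_sumr normrM gtr0_norm ?invr_gt0// mulrC ler_pdivrMr.
Qed.

(** Row [i] is split into [k i] equal copies, which preserves the l1 norm and makes the weights
    uniformly small. Signs from [exists_signs] are then fixed, and only the rows of sign +1 are
    kept, doubled: this changes the norm by exactly the signed sum. *)
Lemma halving (I : finType) (a : I -> 'cV[R]_d) (l dl : R) :
  (0 < d)%N -> (0 < #|I|)%N -> spanning a -> (forall i, a i != 0) ->
  0 < l -> ln (4 * #|I|%:R) <= l -> 0 < dl ->
  2048 * d%:R * l <= dl ^+ 2 * #|I|%:R ->
  exists (m : nat) (b : 'I_m -> 'cV[R]_d),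
    [/\ m%:R <= 5 / 8 * #|I|%:R :> R, forall j, b j != 0 &
      forall x, `|l1 b x - l1 a x| <= dl * l1 a x].
Proof.
move=> d0 I0 spa an0 l0 lI dl0 dlI.
have d0R : 0 < d%:R :> R by rewrite ltr0n.
have I0R : 0 < #|I|%:R :> R by rewrite ltr0n.
have [w w0 [tauw sumw]] := lewis_weights spa an0.
(* The weights total at most [4 * d], so with this threshold splitting adds at most a quarter of the
   original number of rows. *)
pose eta : R := 16 * d%:R / #|I|%:R.
have eta0 : 0 < eta by rewrite divr_gt0// mulr_gt0.
pose k i := (Num.truncn (w i / eta)).+1.
have k0 i : 0 < (k i)%:R :> R by rewrite ltr0n.
pose S : finType := {i : I & 'I_(k i)}.
pose s0 i : S := existT (fun i => 'I_(k i)) i (Ordinal (ltn0Sn _)).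
pose b (s : S) := (k (tag s))%:R^-1 *: a (tag s).
pose v (s : S) := w (tag s) / (k (tag s))%:R.
have sumS (F : I -> R) :
    \sum_(s : S) F (tag s) = \sum_i (k i)%:R * F i.
  transitivity (\sum_i \sum_(c < k i) F i).
    by rewrite (sig_big_dep xpredT (fun i c => true) (fun i c => F i)).
  by apply: eq_bigr => i _; rewrite sumr_const card_ord mulr_natl.
have dotb s x : dot (b s) x = (k (tag s))%:R^-1 * dot (a (tag s)) x.
  by rewrite dotZl.
have l1b x : l1 b x = l1 a x.
  rewrite /l1; under eq_bigr do rewrite dotb.
  rewrite (sumS (fun i => `|(k i)%:R^-1 * dot (a i) x|)).
  apply: eq_bigr => i _; rewrite normrM gtr0_norm ?invr_gt0//.
  by rewrite mulrA mulfV ?mul1r ?gt_eqF.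
have spb : spanning b.
  move=> x bx; apply: spa => i; have := bx (s0 i).
  by move=> /eqP; rewrite dotb mulf_eq0 invr_eq0 gt_eqF//= => /eqP.
have v0 s : 0 < v s by rewrite divr_gt0.
have veta s : v s <= eta.
  rewrite ler_pdivrMr// mulrC -ler_pdivrMr//.
  exact: ltW (truncnS_gt _).
(* Each of the [k] copies contributes [(w / k)^-1 * k^-1 ^+ 2], which totals [w^-1]; so the Lewis
   condition passes to the copies. *)
have gramb : gram b v = gram a w.
  rewrite -[LHS]mulmx1 -[RHS]mulmx1; apply/matrixP => i j.
  pose y : 'cV[R]_d := delta_mx j 0.
  have E (M : 'M[R]_d) : (M *m 1%:M) i j = dot (delta_mx i 0) (M *m y).
    by rewrite mulmx1 /dot trmx_delta -colE -rowE !mxE.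
  rewrite !E !dot_gram.
  under eq_bigr do rewrite !dotb.
  rewrite (sumS (fun t => (w t / (k t)%:R)^-1 *
    ((k t)%:R^-1 * dot (a t) (delta_mx i 0)) * ((k t)%:R^-1 * dot (a t) y))).
  apply: eq_bigr => t _; field.
  by rewrite gt_eqF// gt_eqF.
have taub s : tau b v (b s) <= 4 * v s ^+ 2.
  rewrite /tau gramb dotZl -scalemxAr dotZr -/(tau a w _).
  rewrite /v; set t := _^-1; have t0 : 0 <= t by rewrite invr_ge0.
  rewrite (_ : 4 * (w (tag s) * t) ^+ 2 = t * (t * (4 * w (tag s) ^+ 2))).
    by rewrite !ler_wpM2l.
  by ring.
have cS : #|S|%:R <= 5 / 4 * #|I|%:R :> R.
  have -> : #|S|%:R = \sum_(s : S) 1 :> R by rewrite sumr_const.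
  rewrite (sumS (fun=> 1)).
  apply: (@le_trans _ _ (\sum_i (w i / eta + 1))).
    apply: ler_sum => i _; rewrite mulr1 -natr1 lerD2r.
    by rewrite truncn_le// divr_ge0 ?ltW.
  rewrite big_split/= sumr_const -mulr_suml.
  have : (\sum_i w i) / eta <= #|I|%:R / 4.
    rewrite ler_pdivrMr// (le_trans sumw)// /eta.
    by rewrite (_ : _ * (_ / _) = 4 * d%:R)//; field; rewrite gt_eqF.
  by set q := _ / eta; rewrite /= -[1 *+ _]/(#|I|%:R); lra.
have S0 : (0 < #|S|)%N.
  case/card_gt0P: I0 => i _; apply/card_gt0P.
  by exists (s0 i).
(* Makes [l / lam] equal to [dl / 4]; the assumption with 2048 then bounds the other error term by
   [dl / 4] too. *)
pose lam := 4 * l / dl.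
have lam0 : 0 < lam by rewrite divr_gt0// mulr_gt0.
have lS : ln (2 * #|S|%:R) <= l.
  apply: le_trans lI; rewrite ler_ln ?posrE ?mulr_gt0 ?ltr0n//; move: cS; lra.
have [e eb] := exists_signs spb v0 veta taub S0 lam0 lS.
have {}eb x : `|\sum_s (-1) ^+ e s * `|dot (b s) x| | <= dl * l1 a x.
  apply: (le_trans (eb x)); rewrite l1b ler_wpM2r ?l1_ge0//.
  have -> : l / lam = dl / 4 by rewrite /lam; field; rewrite !gt_eqF.
  have : 8 * lam * eta <= dl / 4; last by lra.
  rewrite (_ : 8 * lam * eta = (2048 * d%:R * l) / (4 * #|I|%:R * dl)); last first.
    by rewrite /lam /eta; field; rewrite !gt_eqF.
  rewrite ler_pdivrMr ?mulr_gt0//; apply: (le_trans dlI).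
  by rewrite le_eqVlt; apply/orP; left; apply/eqP; field.
(* [false] encodes the sign +1. Negating all signs if necessary, at most half of the split rows have
   it: [5 / 4] becomes [5 / 8]. *)
have [e' [e'b e'S]] : exists e' : {ffun S -> bool},
    (forall x, `|\sum_s (-1) ^+ e' s * `|dot (b s) x| | <= dl * l1 a x) /\
    #|[pred s | ~~ e' s]|%:R <= #|S|%:R / 2 :> R.
  have := cardC [pred s | e s] => /(congr1 (fun n => n%:R : R)).
  rewrite natrD => cE.
  have [le|lt] := leP #|[pred s | ~~ e s]|%:R (#|S|%:R / 2 : R); first by exists e.
  exists [ffun s => ~~ e s]; split.
    move=> x; rewrite -normrN -sumrN; move: (eb x).
    by under [in X in _ -> X]eq_bigr do rewrite ffunE signrN mulNr opprK.
  rewrite (@eq_card _ [pred s | ~~ _] [pred s | e s]); last first.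
    by move=> s; rewrite !inE ffunE negbK.
  have cc : #|[predC [pred s | e s]]| = #|[pred s | ~~ e s]|.
    by apply: eq_card => s; rewrite !inE.
  rewrite cc in cE; lra.
exists #|[pred s | ~~ e' s]|, (fun j => 2 *: b (enum_val j)); split.
- move: e'S cS; lra.
- move=> j; rewrite !scaler_eq0 !negb_or an0 invr_eq0 !pnatr_eq0//=.
- move=> x; rewrite -(l1b x).
  rewrite -[X in X - _](_ : \sum_s (1 + (-1) ^+ e' s) * `|dot (b s) x| = _).
    rewrite /l1 -sumrB; under eq_bigr do rewrite mulrDl mul1r addrAC subrr add0r.
    by rewrite -/(l1 b x) l1b.
  rewrite /l1 -(big_enum_val (fun s => `|dot (2 *: b s) x|))/= [RHS]big_mkcond/=.
  apply: eq_bigr => s _; rewrite inE (dotZl 2 (b s)) normrM gtr0_norm//.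
  by case: (e' s); rewrite ?expr0 ?expr1 ?subrr ?mul0r.
Qed.

(* With [2048] from [halving], the factor [400 = 20 ^ 2] makes the relative
   error of the [t]-th halving at most [(4 / 5) ^+ t / 20]; these sum to [1 / 4]. *)
Definition sparse_const : R := 400 * 2048.

Lemma sparse_const_gt0 : 0 < sparse_const.
Proof. by apply: mulr_gt0; rewrite ltr0n. Qed.

(** Equals 1 at [t = 0] and stays above [3 / 4]; its successive decrements are exactly the errors of
    the halvings. *)
Let factor t : R := 3 / 4 + 1 / 4 * (4 / 5) ^+ t.

Lemma sparsify_iter (l : R) t N (a : 'I_N -> 'cV[R]_d) :
  (0 < d)%N -> 0 < l -> (0 < N)%N -> spanning a -> (forall i, a i != 0) ->
  ln (4 * N%:R) <= l -> N%:R <= sparse_const * d%:R * l * (8 / 5) ^+ t ->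
  exists (m : nat) (b : 'I_m -> 'cV[R]_d),
    m%:R <= sparse_const * d%:R * l /\
    forall x, factor t * l1 a x <= l1 b x /\ factor t * l1 b x <= l1 a x.
Proof.
move=> d0 l0; have d0R : 0 < d%:R :> R by rewrite ltr0n.
have C0 := mulr_gt0 (mulr_gt0 sparse_const_gt0 d0R) l0.
elim: t N a => [|t IHt] N a N0 spa an0 lN Nt.
  exists N, a; rewrite expr0 mulr1 in Nt; split => // x.
  by rewrite /factor expr0 mulr1 -mulrDl (_ : 3 + 1 = 4) ?divff ?mul1r//; ring.
have p0 : 0 < (4 / 5) ^+ t :> R by rewrite exprn_gt0// divr_gt0.
have p1 : (4 / 5) ^+ t <= 1 :> R by rewrite exprn_ile1//; lra.
have fS : factor t.+1 = factor t - 1 / 20 * (4 / 5) ^+ t.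
  by rewrite /factor exprS; field.
(* Either the bound for [t] already holds and induction applies to [a] itself, or there are enough
   rows to halve with error [dl]. *)
have [Nt'|Nt'] := leP N%:R (sparse_const * d%:R * l * (8 / 5) ^+ t).
  have [m [b [mC bb]]] := IHt N a N0 spa an0 lN Nt'.
  exists m, b; split => // x; have [h1 h2] := bb x.
  have := l1_ge0 a x; have := l1_ge0 b x; rewrite fS.
  set q := (4 / 5) ^+ t in p0 *; move=> sb sa.
  by split; [apply: le_trans h1|apply: le_trans h2]; rewrite ler_wpM2r//; lra.
pose dl : R := 1 / 20 * (4 / 5) ^+ t.
have dl0 : 0 < dl by rewrite mulr_gt0//; lra.
have dlN : 2048 * d%:R * l <= dl ^+ 2 * #|'I_N|%:R.
  rewrite card_ord; apply: (@le_trans _ _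
      (dl ^+ 2 * (sparse_const * d%:R * l * (8 / 5) ^+ t))); last first.
    by rewrite ler_wpM2l ?sqr_ge0// ltW.
  (* Since [(4 / 5) ^+ 2 * (8 / 5) = 128 / 125] exceeds 1, the row count compensates for the
     decreasing error at every [t]. *)
  have -> : dl ^+ 2 * (sparse_const * d%:R * l * (8 / 5) ^+ t) =
      2048 * d%:R * l * (4 / 5 * (4 / 5) * (8 / 5)) ^+ t.
    by rewrite /dl /sparse_const !exprMn; field.
  apply: ler_peMr; last by apply: exprn_ege1; lra.
  by apply: mulr_ge0 (ltW l0); apply: mulr_ge0; rewrite ler0n.
have I0 : (0 < #|'I_N|)%N by rewrite card_ord.
have [|m [b [mN bn0 bb]]] := halving d0 I0 spa an0 l0 _ dl0 dlN.
  by rewrite card_ord.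
rewrite card_ord in mN.
have dl1 : dl <= 1 / 20 by rewrite /dl; lra.
have spb : spanning b.
  move=> x bx; apply: spa => i; apply/eqP; rewrite -normr_le0.
  apply: (le_trans (le_l1 a x i)); have := bb x.
  rewrite {1}/l1 big1 => [|j _]; last by rewrite bx normr0.
  have := l1_ge0 a x; rewrite ler_norml => S0 /andP[h _]; nra.
have m0 : (0 < m)%N.
  case: (posnP m) => // m0.
  have [i _] : exists i : 'I_N, true by exists (Ordinal N0).
  have : a i = 0; last by move/eqP; rewrite (negbTE (an0 i)).
  by apply: spb => j; exfalso; case: j => j; rewrite m0.
have [||m' [b' [m'C bb']]] := IHt m b m0 spb bn0.
- apply: le_trans lN; rewrite ler_ln ?posrE ?mulr_gt0 ?ltr0n//.
  have : 0 <= N%:R :> R by []; lra.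
- apply: (le_trans mN); rewrite mulrC -ler_pdivlMr//; move: Nt; rewrite exprS.
  by set q := (8 / 5) ^+ t; lra.
exists m', b'; split => // x; have [h1 h2] := bb' x; have := bb x.
have := l1_ge0 a x; have := l1_ge0 b x; have := l1_ge0 b' x.
rewrite ler_norml fS -/dl => s1 s2 s3 /andP[h3 h4].
(* As [factor t] lies in [[3/4, 1]], a further relative error [dl] costs at most the decrement [dl]
   of [factor], in both directions. *)
have f0 : 3 / 4 <= factor t by rewrite /factor; lra.
have f1 : factor t <= 1 by rewrite /factor; lra.
split; nra.
Qed.

Lemma l1_sparsify (I : finType) (a : I -> 'cV[R]_d) (l : R) :
  (0 < d)%N -> 0 < l -> (0 < #|I|)%N -> spanning a -> (forall i, a i != 0) ->
  ln (4 * #|I|%:R) <= l ->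
  exists (m : nat) (b : 'I_m -> 'cV[R]_d),
    m%:R <= sparse_const * d%:R * l /\
    forall x, 3 / 4 * l1 a x <= l1 b x /\ 3 / 4 * l1 b x <= l1 a x.
Proof.
move=> d0 l0 I0 spa an0 lI.
pose a' (j : 'I_#|I|) := a (enum_val j).
have l1a x : l1 a' x = l1 a x.
  by rewrite /l1 -(big_enum_val (fun i => `|dot (a i) x|)).
have spa' : spanning a'.
  by move=> x ax; apply: spa => i; have := ax (enum_rank i); rewrite /a' enum_rankK.
have d0R : 0 < d%:R :> R by rewrite ltr0n.
have C0 := mulr_gt0 (mulr_gt0 sparse_const_gt0 d0R) l0.
have [t It] : exists t, #|I|%:R <= sparse_const * d%:R * l * (8 / 5) ^+ t.
  pose q := #|I|%:R / (sparse_const * d%:R * l).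
  (* The exponent is doubled because [8 / 5] is below 2 while its square is above. *)
  exists (2 * (Num.truncn q).+1)%N; rewrite mulrC -ler_pdivrMr//.
  apply: (le_trans (ltW (truncnS_gt q))); rewrite exprM.
  apply: (@le_trans _ _ (2 ^+ (Num.truncn q).+1)).
    by rewrite -natrX ler_nat ltnW// ltn_expl.
  by apply: lerXn2r; rewrite ?nnegrE; lra.
have [m [b [mC bb]]] := sparsify_iter d0 l0 I0 spa' (fun j => an0 _) lI It.
exists m, b; split => // x; have [h1 h2] := bb x.
rewrite l1a in h1 h2; have := l1_ge0 a x; have := l1_ge0 b x.
have : 0 <= (4 / 5) ^+ t :> R by rewrite exprn_ge0//; lra.
rewrite /factor in h1 h2; move: h1 h2; set p := (4 / 5) ^+ t => h1 h2 p0 s1 s2.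
by split; [apply: le_trans h1|apply: le_trans h2]; rewrite ler_wpM2r//; lra.
Qed.

End Sparsification.

(** * Hierarchical partitions *)

Section LFNormBounds.
Variables (R : realType) (X : finMetricType R).
Implicit Types (mu : LF X) (C : {set X}) (p q : X).

Definition cut C p q : R := `|(p \in C)%:R - (q \in C)%:R|.

Lemma LF_norm_le (J : finType) mu (al : J -> R) (p q : J -> X) :
  (mu : {ffun X -> R^o}) = \sum_j al j *: (indic1 (p j) - indic1 (q j)) ->
  LF_norm mu <= \sum_j `|al j| * mdist (p j) (q j).
Proof.
move=> muE; apply: ge_inf; first by exists 0; exact: LF_costs_ge0.
exists #|J|, (al \o enum_val), (p \o enum_val), (q \o enum_val); split.
  by rewrite muE -(big_enum_val (fun j => al j *: (indic1 (p j) - indic1 (q j)))).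
by rewrite -(big_enum_val (fun j => `|al j| * mdist (p j) (q j))).
Qed.

(** The left side is a seminorm in [mu], so the bound need only be known on the differences
    [indic1 p - indic1 q], where it is the hypothesis on cuts. *)
Lemma cut_sum_le_LF_norm (W : {set X} -> R) (D : R) mu :
  (forall C, 0 <= W C) -> 0 <= D ->
  (forall p q, \sum_C W C * cut C p q <= D * mdist p q) ->
  \sum_C W C * `|\sum_(x in C) mu x| <= D * LF_norm mu.
Proof.
move=> W0 D0 WD.
have le_cost s : LF_costs (mu : {ffun X -> R^o}) s ->
    \sum_C W C * `|\sum_(x in C) mu x| <= D * s.
  move=> [r [a [p [q [-> ->]]]]].
  apply: (@le_trans _ _
      (\sum_C W C * \sum_(j < r) `|a j| * cut C (p j) (q j))).
    apply: ler_sum => C _; rewrite ler_wpM2l//.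
    have -> : \sum_(x in C) (\sum_(j < r) a j *: (indic1 (p j) - indic1 (q j))) x =
        \sum_(j < r) a j * ((p j \in C)%:R - (q j \in C)%:R).
      under eq_bigr do rewrite sum_ffunE; rewrite exchange_big/=.
      have ind y : \sum_(x in C) (x == y)%:R = (y \in C)%:R :> R.
        rewrite big_mkcond/= (bigD1 y)//= big1 => [|x /negbTE ->].
          by rewrite eqxx addr0; case: (y \in C).
        by case: ifP.
      apply: eq_bigr => j _; rewrite -!ind -sumrB mulr_sumr.
      by apply: eq_bigr => x _; rewrite !ffunE.
    apply: (le_trans (ler_norm_sum _ _ _)).
    by apply: ler_sum => j _; rewrite normrM.
  under eq_bigr do rewrite mulr_sumr; rewrite exchange_big/= mulr_sumr.
  apply: ler_sum => j _; under eq_bigr do rewrite mulrCA.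
  by rewrite -mulr_sumr [leRHS]mulrCA ler_wpM2l.
(* Passing to the infimum divides by [D], so [D = 0] is treated apart. *)
move: D0; rewrite le_eqVlt => /orP[/eqP D0|D0].
  have [s ms] := LF_costs_nonempty mu.
  by rewrite -D0 mul0r; have := le_cost _ ms; rewrite -D0 mul0r.
rewrite mulrC -ler_pdivrMr//; apply: lb_le_inf.
  exact: LF_costs_nonempty.
by move=> s ms; rewrite ler_pdivrMr// mulrC; exact: le_cost.
Qed.

End LFNormBounds.

Section Hierarchy.
Variables (R : realType) (X : finMetricType R) (L : nat) (c : nat -> X -> X).
Implicit Types (i j : nat) (x y p q u : X) (C : {set X}).

(** Requiring agreement of the centers at all levels from [i] up forces the partitions to be nested,
    whatever the maps [c j]. At level [L] the condition is void. *)
Definition eqv i x y := [forall j : 'I_L, (i <= j)%N ==> (c j x == c j y)].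

Lemma eqv_refl i x : eqv i x x.
Proof. by apply/forallP => j; rewrite eqxx implybT. Qed.

Lemma eqv_sym i x y : eqv i x y = eqv i y x.
Proof. by apply: eq_forallb => j; rewrite eq_sym. Qed.

Lemma eqv_trans i x y z : eqv i x y -> eqv i y z -> eqv i x z.
Proof.
move=> /forallP xy /forallP yz; apply/forallP => j; apply/implyP => ij.
by move: (xy j) (yz j); rewrite ij/= => /eqP -> /eqP ->.
Qed.

Lemma eqv_le i j x y : (i <= j)%N -> eqv i x y -> eqv j x y.
Proof.
move=> ij /forallP xy; apply/forallP => k; apply/implyP => jk.
by move: (xy k); rewrite (leq_trans ij jk).
Qed.

Lemma eqv_center i x y : (i < L)%N -> eqv i x y -> c i x = c i y.
Proof. by move=> iL /forallP/(_ (Ordinal iL)); rewrite leqnn => /eqP. Qed.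

Lemma eqv_top x y : eqv L x y.
Proof. by apply/forallP => j; rewrite leqNgt ltn_ord. Qed.

Definition cluster i x : {set X} := [set y | eqv i x y].

Lemma eq_cluster i x y : eqv i x y -> cluster i x = cluster i y.
Proof.
move=> xy; apply/setP => z; rewrite !inE; apply/idP/idP; last exact: eqv_trans.
by apply: eqv_trans; rewrite eqv_sym.
Qed.

(** [pick] sees only the cluster, so equivalent points get the same representative; the default is
    never reached, as [x] lies in its cluster. *)
Definition repr i x := odflt x [pick y in cluster i x].

Lemma eqv_repr i x : eqv i x (repr i x).
Proof.
by rewrite /repr; case: pickP => [y|/(_ x)]; rewrite inE ?eqv_refl.
Qed.

Lemma eq_repr i x y : eqv i x y -> repr i x = repr i y.
Proof.
move=> xy; rewrite /repr (eq_cluster xy).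
by case: pickP => // /(_ y); rewrite inE eqv_refl.
Qed.

Lemma repr_id i x : repr i (repr i x) = repr i x.
Proof. by apply/esym/eq_repr/eqv_repr. Qed.

Lemma repr_eqP i x u : (repr i x == u) = (repr i u == u) && eqv i u x.
Proof.
apply/eqP/andP => [<-|[/eqP ru ux]].
  by rewrite repr_id eqxx eqv_sym eqv_repr.
by rewrite -(eq_repr ux).
Qed.

Variable D : nat -> R.

(** [D i.+1] is the length of the edge from a level-[i] cluster to its parent. A set that is a
    cluster at several levels collects all these lengths. *)
Definition tree_weight C : R :=
  \sum_(i < L) \sum_(u | repr i u == u) (cluster i u == C)%:R * D i.+1.

Lemma sum_tree_weight (F : {set X} -> R) :
  \sum_C tree_weight C * F C =
  \sum_(i < L) D i.+1 * \sum_(u | repr i u == u) F (cluster i u).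
Proof.
under eq_bigr do rewrite mulr_suml; rewrite exchange_big/=.
apply: eq_bigr => i _.
under eq_bigr do rewrite mulr_suml; rewrite exchange_big/= mulr_sumr.
apply: eq_bigr => u _.
rewrite (bigD1 (cluster i u))//= eqxx mul1r big1 ?addr0// => C.
by rewrite eq_sym => /negbTE ->; rewrite !mul0r.
Qed.

Hypothesis D0 : forall i, 0 <= D i.

Lemma tree_weight_ge0 C : 0 <= tree_weight C.
Proof.
by apply: sumr_ge0 => i _; apply: sumr_ge0 => u _; rewrite mulr_ge0// ler0n.
Qed.

Lemma tree_weight_neq0 C : tree_weight C != 0 -> exists i x, C = cluster i x.
Proof.
move=> WC; apply: contrapT => noC; move/eqP: WC; apply.
rewrite /tree_weight big1// => i _; rewrite big1// => u _.
case: eqP => [iu|_]; last by rewrite mul0r.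
by exfalso; apply: noC; exists i, u.
Qed.

Lemma tree_weight_set0 : tree_weight finset.set0 = 0.
Proof.
apply/eqP/negPn/negP => /tree_weight_neq0[i [x]] /setP/(_ x).
by rewrite !inE eqv_refl.
Qed.

(* The clusters through a given point are nested, so a cluster is determined by
   one of its points and its cardinality. *)
Lemma card_tree_weight :
  (#|[set C | tree_weight C != 0%R]| <= #|X| * #|X|.+1)%N.
Proof.
have [x0 _|X0] := pickP (fun _ : X => true); last first.
  rewrite (_ : [set _ | _] = finset.set0) ?cards0//; apply/setP => C; rewrite !inE.
  by apply/negbTE/negP => /tree_weight_neq0[i [x _]]; have := X0 x.
pose code C : X * 'I_#|X|.+1 :=
  (odflt x0 [pick x in C], inord #|C|).
have codeP i x : eqv i x (odflt x0 [pick y in cluster i x]).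
  by case: pickP => [y|/(_ x)]; rewrite inE ?eqv_refl.
have code_inj : {in [set C | tree_weight C != 0] &, injective code}.
  move=> C C'; rewrite !inE => /tree_weight_neq0[i [x ->]].
  move=> /tree_weight_neq0[j [y ->]] [xy] /(congr1 val)/=.
  rewrite !inordK ?ltnS ?max_card// => sz.
  have := codeP i x; have := codeP j y; rewrite -xy.
  set z := odflt _ _; move: z => z yz xz; move: sz.
  rewrite (eq_cluster xz) (eq_cluster yz).
  wlog ij : i j {x y xy xz yz} / (i <= j)%N => [wl|sz].
    by case/orP: (leq_total i j) => [/wl//|/wl + /esym sz]; move=> /(_ sz).
  apply/eqP; rewrite eqEcard sz leqnn andbT.
  by apply/fintype.subsetP => t; rewrite !inE; exact: eqv_le.
have := subset_leq_card (finset.subsetT (code @: [set C | tree_weight C != 0])).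
by rewrite (card_in_imset code_inj) cardsT card_prod card_ord.
Qed.

Hypothesis eqv0 : forall x y, eqv 0 x y -> x = y.
Hypothesis eqvD : forall i x y, (i <= L)%N -> eqv i x y -> mdist x y <= D i.

Lemma tree_weight_set1 x : (0 < L)%N -> D 1 <= tree_weight [set x].
Proof.
move=> L0; have sum_ge0 i (P : pred X) :
    0 <= \sum_(u | P u) (cluster i u == [set x])%:R * D i.+1.
  by apply: sumr_ge0 => u _; rewrite mulr_ge0// ler0n.
rewrite /tree_weight (bigD1 (Ordinal L0))//= (bigD1 x)/=; last first.
  by rewrite -(eqv0 (eqv_repr 0 x)).
rewrite (_ : cluster 0 x == _) ?mul1r -?addrA ?lerDl ?addr_ge0//.
  by apply: sumr_ge0 => i _; exact: sum_ge0.
apply/eqP/setP => y; rewrite !inE; apply/idP/eqP => [/eqv0//|->].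
exact: eqv_refl.
Qed.

(* The mass [mu] is moved up the hierarchy, from the representative of each
   cluster to the representative of its parent. *)
Lemma LF_norm_le_tree (mu : LF X) :
  LF_norm mu <= \sum_C tree_weight C * `|\sum_(x in C) mu x|.
Proof.
(* The mass of the level-[i] cluster represented by [u], zero when [u] represents none. *)
pose al (u : 'I_L * X) : R := \sum_(x | repr u.1 x == u.2) mu x.
have muE : (mu : {ffun X -> R^o}) =
    \sum_u al u *: (indic1 u.2 - indic1 (repr u.1.+1 u.2)).
  rewrite -(pair_bigA _ (fun (i : 'I_L) u =>
    al (i, u) *: (indic1 u - indic1 (repr i.+1 u))))/=.
  have lev (i : 'I_L) : \sum_u al (i, u) *: (indic1 u - indic1 (repr i.+1 u))
      = \sum_x mu x *: indic1 (repr i x)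
        - \sum_x mu x *: indic1 (repr i.+1 x).
    rewrite -sumrB [RHS](partition_big (repr i) xpredT)//=; apply: eq_bigr => u _.
    rewrite /al scaler_suml; apply: eq_bigr => x /= /eqP xu.
    rewrite -scalerBr -xu; congr (_ *: (_ - indic1 _)).
    by apply/esym/eq_repr/(eqv_le (leqnSn i))/eqv_repr.
  under eq_bigr do rewrite lev.
  pose f i := \sum_x mu x *: indic1 (repr i x).
  have -> : \sum_(i < L) (f i - f i.+1) = f 0 - f L.
    rewrite -[RHS]opprB -(telescope_sumr _ (leq0n L)) big_mkord -sumrN.
    by apply: eq_bigr => i _; rewrite opprB.
  have -> : f 0 = mu.
    apply/ffunP => y; rewrite sum_ffunE (bigD1 y)//= big1 => [|x xy].
      by rewrite !ffunE -(eqv0 (eqv_repr 0 y)) eqxx addr0 /GRing.scale/= mulr1.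
    by rewrite !ffunE -(eqv0 (eqv_repr 0 x)) eq_sym (negbTE xy) scaler0.
  (* At level [L] all points share one representative, which receives the total mass, zero. *)
  suff -> : f L = 0 by rewrite subr0.
  have [x0 _|X0] := pickP (fun _ : X => true); last first.
    by rewrite /f big1// => x; have := X0 x.
  rewrite /f; under eq_bigr => x _ do rewrite (eq_repr (eqv_top x x0)).
  rewrite -scaler_suml (_ : \sum_x mu x = 0) ?scale0r//.
  by apply/eqP; exact: (valP mu).
apply: (le_trans (LF_norm_le muE)); rewrite sum_tree_weight.
rewrite -(pair_bigA _ (fun (i : 'I_L) u => `|al (i, u)| * mdist u (repr i.+1 u)))/=.
apply: ler_sum => i _; rewrite mulr_sumr (bigID (fun u => repr i u == u))/=.
rewrite [X in _ + X]big1 ?addr0 => [|u ru]; last first.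
  rewrite /al/= big_pred0 ?normr0 ?mul0r// => x.
  by rewrite repr_eqP (negbTE ru).
apply: ler_sum => u ru; rewrite mulrC /al/= ler_pM// ?mdist_ge0//.
  by apply: eqvD => //; exact: eqv_repr.
rewrite (_ : \sum_(_ | _) _ = \sum_(x in cluster i u) mu x)//.
by apply: eq_bigl => x; rewrite repr_eqP ru inE.
Qed.

Variable r : nat -> R.
Hypothesis r0 : forall i, 0 <= r i.
Hypothesis r2 : forall i, 2 * r i <= r i.+1.
Hypothesis Dr : forall i, D i = 2 * r i.

(** Clusters of level [i] separate [p] from [q] only if some [c j] with [j >= i] does. Charging such
    a [j] for all levels below gives a geometric sum; the 8 combines this factor 2, the two clusters
    cut, and [D = 2 r]. *)
Lemma tree_stretch p q :
  \sum_C tree_weight C * cut C p q <=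
    8 * \sum_(j < L) r j.+1 * (c j p != c j q)%:R.
Proof.
have sum_r j : \sum_(i < L | (i <= j)%N) r i.+1 <= 2 * r j.+1.
  apply: (@le_trans _ _ (\sum_(i < j.+1) r i.+1)).
    rewrite -(big_mkord (fun i => i <= j)%N (fun i => r i.+1)).
    rewrite -(big_mkord xpredT (fun i => r i.+1)).
    rewrite big_mkcond/= [leRHS](@big_nat_widen _ _ _ _ _ (maxn L j.+1)) ?leq_maxr//.
    rewrite (@big_nat_widen _ _ _ 0%N L (maxn L j.+1)) ?leq_maxl//=.
    rewrite big_mkcond/= [leRHS]big_mkcond/=; apply: ler_sum => i _.
    by rewrite ltnS; case: (i <= j)%N; case: (i < L)%N.
  elim: j => [|j IHj]; first by rewrite big_ord1 ler_peMl//; lra.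
  by rewrite big_ord_recr/=; move: IHj (r2 j.+1); lra.
rewrite sum_tree_weight.
apply: (@le_trans _ _ (\sum_(i < L) D i.+1 * (2 * (~~ eqv i p q)%:R))).
  apply: ler_sum => i _; rewrite ler_wpM2l//.
  have fix1 x : \sum_(u | repr i u == u) (x \in cluster i u)%:R = 1 :> R.
    rewrite big_mkcond/= (bigD1 (repr i x))//= big1 => [|u ux].
      by rewrite repr_id eqxx inE eqv_sym eqv_repr addr0.
    have := repr_eqP i x u; rewrite eq_sym (negbTE ux).
    by case: (repr i u == u) => //=; rewrite inE => <-.
  have [pq|pq]/= := boolP (eqv i p q).
    rewrite mulr0 big1// => u _; rewrite /cut !inE.
    suff -> : eqv i u p = eqv i u q by rewrite subrr normr0.
    apply/idP/idP => h; apply: (eqv_trans h) => //; by rewrite eqv_sym.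
  rewrite mulr1 [leRHS](_ : 2 = 1 + 1)//.
  rewrite -[X in X + _](fix1 p) -[X in _ + X](fix1 q) -big_split/=.
  by apply: ler_sum => u _; rewrite /cut (le_trans (ler_normB _ _))// !normr_nat.
apply: (@le_trans _ _ (\sum_(i < L) 4 * r i.+1 *
    \sum_(j < L | (i <= j)%N) (c j p != c j q)%:R)).
  apply: ler_sum => i _; rewrite Dr.
  rewrite (_ : 2 * r i.+1 * (2 * _) = 4 * r i.+1 * (~~ eqv i p q)%:R); last by ring.
  rewrite ler_wpM2l ?mulr_ge0//; have [|] := boolP (eqv i p q) => pq.
    by apply: sumr_ge0 => j _; rewrite ler0n.
  have [j] := forallPn pq; rewrite negb_imply => /andP[ij cj].
  rewrite (bigD1 j)//= cj lerDl; apply: sumr_ge0 => k _; exact: ler0n.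
under eq_bigr do rewrite mulr_sumr.
rewrite (exchange_big_dep xpredT)//= mulr_sumr; apply: ler_sum => j _.
rewrite -mulr_suml -mulr_sumr mulrA ler_wpM2r ?ler0n//.
by move: (sum_r j); lra.
Qed.

End Hierarchy.

(** * Random partitions *)

(** A harmonic sum: in increasing order of [f], the [j]-th element has count at least [j]. The
    induction removes a maximizer of [f], whose count is [#|S|]. *)
Lemma sum_inv_count_le (R : realType) (T : finType) (f : T -> R) (S : {set T}) :
  (0 < #|S|)%N ->
  \sum_(u in S) #|[set v in S | f v <= f u]|%:R^-1 <= 1 + ln #|S|%:R :> R.
Proof.
move: {2}#|S| (erefl #|S|) => k; elim: k S => [|k IHk] S Sk; first by rewrite Sk.
move=> _.
have [u0 u0S] : exists u0, u0 \in S by apply/card_gt0P; rewrite Sk.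
have [um umS um_max] : exists2 um, um \in S & forall v, v \in S -> f v <= f um.
  by case: (arg_maxP f u0S) => um h1 h2; exists um.
have cS' : #|S :\ um| = k.
  by have := cardsD1 um S; rewrite umS Sk add1n => -[].
rewrite (big_setD1 um)//=.
have -> : [set v in S | f v <= f um] = S.
  apply/setP => v; rewrite inE; case vS: (v \in S) => //=; exact: um_max.
rewrite Sk; case: k => [|k] in IHk Sk cS' *.
  by rewrite invr1 ln1 addr0 (cards0_eq cS') big_set0 addr0.
have := IHk _ cS'; rewrite {1}cS' => /(_ isT).
have le1 : \sum_(u in S :\ um) #|[set v in S | f v <= f u]|%:R^-1 <=
    \sum_(u in S :\ um) #|[set v in S :\ um | f v <= f u]|%:R^-1 :> R.
  apply: ler_sum => u uS; rewrite lef_pV2 ?posrE ?ltr0n ?ler_nat.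
  - apply/subset_leq_card/fintype.subsetP => v.
    by rewrite !inE => /andP[/andP[_ ->]].
  - apply/card_gt0P; exists u; rewrite !inE lexx andbT.
    by move: uS; rewrite !inE => /andP[].
  - by apply/card_gt0P; exists u; rewrite inE uS lexx.
have lnS : k.+2%:R^-1 <= ln k.+2%:R - ln k.+1%:R :> R.
  have : ln (1 + - k.+2%:R^-1) <= - k.+2%:R^-1 :> R.
    by apply: le_ln1Dx; rewrite ltrN2 invf_lt1 ?ltr0n// ltr1n.
  have -> : 1 + - k.+2%:R^-1 = k.+1%:R / k.+2%:R :> R.
    have k2 : k.+2%:R != 0 :> R by rewrite pnatr_eq0.
    by apply: (mulIf k2); rewrite divfK// mulrDl mulNr mulVf// mul1r -natr1 addrK.
  by rewrite ln_div ?posrE ?ltr0n// lerNr opprB.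
rewrite cS'; move: le1 lnS; set y := _^-1; set s1 := \sum_(_ in _) _.
by set s2 := \sum_(_ in _) _; set l1 := ln _; set l2 := ln _; lra.
Qed.

(** If more than [#|K|] weights are nonzero, the corresponding rows of [f] are linearly dependent;
    moving [w] along the dependency keeps all the sums and can be continued until a weight
    vanishes. *)
Lemma caratheodory (R : realType) (O K : finType) (f : O -> K -> R) (w : O -> R) :
  (forall o, 0 <= w o) ->
  exists w' : O -> R, [/\ forall o, 0 <= w' o,
    forall k, \sum_o w' o * f o k = \sum_o w o * f o k &
    (#|[set o | w' o != 0%R]| <= #|K|)%N].
Proof.
have [n] := ubnP #|[set o | w o != 0%R]|.
elim: n w => // n IHn w; rewrite ltnS => wn w0.
have [le|lt] := leqP #|[set o | w o != 0]| #|K|; first by exists w.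
set S := [set o | w o != 0] in wn lt.
pose A : 'M[R]_(#|S|, #|K|) := \matrix_(i, j) f (enum_val i) (enum_val j).
have : kermx A != 0.
  rewrite -mxrank_eq0 mxrank_ker subn_eq0 -ltnNge.
  exact: leq_ltn_trans (rank_leq_col A) lt.
move=> /rowV0Pn[v /sub_kermxP vA v0].
pose c0 o := if [pick i : 'I_#|S| | enum_val i == o] is Some i then v 0 i else 0.
have c0E i : c0 (enum_val i) = v 0 i.
  rewrite /c0; case: pickP => [j /eqP/enum_val_inj -> //|/(_ i)].
  by rewrite eqxx.
have c0S o : c0 o != 0 -> w o != 0.
  rewrite /c0; case: pickP => [j /eqP <- _|]; last by rewrite eqxx.
  by have := enum_valP j; rewrite inE.
have c0f k : \sum_o c0 o * f o k = 0.
  rewrite (bigID (fun o => o \in S))/= [X in _ + X]big1 => [|y yS]; last first.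
    have -> : c0 y = 0; last by rewrite mul0r.
    by apply/eqP; apply: contraNT yS => /c0S; rewrite inE.
  rewrite addr0 big_enum_val/=.
  have := congr1 (fun M : 'rV[R]_#|K| => M 0 (enum_rank k)) vA.
  rewrite !mxE => vAk; rewrite -[RHS]vAk; apply: eq_bigr => i _.
  by rewrite mxE enum_rankK c0E.
have [c [cS c_f [z cz]]] : exists c : O -> R,
    [/\ forall o, c o != 0 -> w o != 0, forall k, \sum_o c o * f o k = 0 &
     exists o, 0 < c o].
  have [i vi] : exists i, v 0 i != 0 by apply/rV0Pn.
  have [ci|ci] := ltP 0 (c0 (enum_val i)).
    by exists c0; split => //; exists (enum_val i).
  exists (fun o => - c0 o); split=> [y|k|].
  - by rewrite oppr_eq0; exact: c0S.
  - by under eq_bigr do rewrite mulNr; rewrite sumrN c0f oppr0.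
  - by exists (enum_val i); rewrite oppr_gt0 lt_neqAle ci c0E vi.
(* [m] is the index whose weight vanishes first, so the others are still nonnegative then. *)
have [m cm m_min] : exists2 m, 0 < c m & forall o, 0 < c o -> w m / c m <= w o / c o.
  case: (@arg_minP _ _ _ z (fun o => 0 < c o) (fun o => w o / c o) cz).
  by move=> m cm m_min; exists m.
pose t := w m / c m.
have t0 : 0 <= t by rewrite divr_ge0// ltW.
pose w1 o := w o - t * c o.
have w10 o : 0 <= w1 o.
  rewrite subr_ge0; have [c_le|c_gt] := leP (c o) 0.
    by rewrite (le_trans _ (w0 o))// mulr_ge0_le0.
  by rewrite -ler_pdivlMr// m_min.
have w1f k : \sum_o w1 o * f o k = \sum_o w o * f o k.
  under eq_bigr do rewrite mulrBl -mulrA.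
  by rewrite sumrB -mulr_sumr c_f mulr0 subr0.
have lt1 : (#|[set o | w1 o != 0%R]| < #|S|)%N.
  apply/proper_card/fintype.properP; split.
    apply/fintype.subsetP => o; rewrite !inE; apply: contraNN => /eqP wo.
    have := @cS o; rewrite /w1 wo eqxx => h.
    have -> : c o = 0 by apply/eqP/negPn/negP => /h.
    by rewrite mulr0 subr0.
  exists m; first by rewrite inE cS// gt_eqF.
  by rewrite inE negbK /w1 /t divfK ?subrr// gt_eqF.
have [w' [w'0 w'f w'K]] := IHn w1 (leq_trans lt1 wn) w10.
by exists w'; split => // k; rewrite w'f w1f.
Qed.

Section RandomPartition.
Variables (R : realType) (X : finMetricType R).
Implicit Types (s : {perm X}) (p q u v x : X) (rho : R).

Definition rank s u : nat := enum_rank (s u).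

Lemma rank_inj s : injective (rank s).
Proof. by move=> u v /val_inj/enum_rank_inj/perm_inj. Qed.

(** Ball carving in the random order [s]. The default [x] is itself admissible when [rho >= 0]. *)
Definition first_center s rho x : X :=
  fintype.arg_min x (fun u => mdist x u <= rho) (rank s).

Lemma first_centerP s rho x : 0 <= rho ->
  mdist x (first_center s rho x) <= rho /\
  forall v, mdist x v <= rho -> (rank s (first_center s rho x) <= rank s v)%N.
Proof.
move=> rho0; rewrite /first_center.
by case: fintype.arg_minnP => [|u xu umin]; rewrite ?mdistxx.
Qed.

Let near p q u : R := Num.min (mdist p u) (mdist q u).
Let far p q u : R := Num.max (mdist p u) (mdist q u).

(* The witness is the center of smaller rank. *)
Lemma separated_by s rho p q : 0 <= rho ->
  first_center s rho p != first_center s rho q ->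
  exists u, [/\ near p q u <= rho, rho < far p q u &
    forall v, near p q v <= rho -> (rank s u <= rank s v)%N].
Proof.
move=> rho0; wlog le : p q / (rank s (first_center s rho p)
    <= rank s (first_center s rho q))%N.
  move=> wl pq; have [le|/ltnW le] :=
      leqP (rank s (first_center s rho p)) (rank s (first_center s rho q)).
    exact: wl.
  have [|u] := wl q p le; first by rewrite eq_sym.
  rewrite /near /far minC maxC => -[h1 h2 h3]; exists u; split => // v.
  by rewrite minC; exact: h3.
have [pc pmin] := first_centerP s p rho0.
have [qc qmin] := first_centerP s q rho0.
move: le pc pmin qc qmin.
set cp := first_center s rho p; set cq := first_center s rho q.
move=> le pc pmin qc qmin pq; exists cp; split.
- by rewrite /near ge_min pc.
- rewrite /far lt_max orbC ltNge; case: (boolP (mdist q cp <= rho)) => // qcp.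
  have : cp = cq by apply: (@rank_inj s); apply/eqP; rewrite eqn_leq le qmin.
  by move/eqP; rewrite (negbTE pq).
- move=> v; rewrite /near ge_min => /orP[/pmin//|/qmin]; exact: leq_trans.
Qed.

Definition first_in u (V : {set X}) : {set {perm X}} :=
  [set s | [forall v in V, rank s u <= rank s v]%N].

(** Composing with a transposition shows that every point of [V] is first equally often, and by
    injectivity of ranks only one point is first for a given [s]. *)
Lemma card_first_in u (V : {set X}) : u \in V ->
  (#|V| * #|first_in u V| <= #|{perm X}|)%N.
Proof.
move=> uV.
have le u' : u' \in V -> (#|first_in u V| <= #|first_in u' V|)%N.
  move=> u'V; rewrite -(card_imset _ (mulgI (tperm u u'))).
  apply/subset_leq_card/fintype.subsetP => _ /imsetP[s + ->].
  rewrite !inE => /forall_inP sV; apply/forall_inP => v vV.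
  rewrite /rank !permM tpermR; apply: sV.
  by case: tpermP.
rewrite -sum_nat_const.
apply: (@leq_trans (\sum_(u' in V) #|first_in u' V|)%N).
  by apply: leq_sum => u' u'V; exact: le.
under eq_bigr do rewrite -sum1_card big_mkcond/=.
rewrite exchange_big/= -sum1_card; apply: leq_sum => s _.
have [/existsP[u1 /andP[u1V u1s]]|/existsPn none] :=
    boolP [exists u1, (u1 \in V) && (s \in first_in u1 V)].
  rewrite (bigD1 u1)//= big1 ?addn0; first by case: ifP.
  move=> u2 /andP[u2V u21]; case: ifP => //; move: u1s; rewrite !inE.
  move=> /forall_inP/(_ _ u2V) le12 /forall_inP/(_ _ u1V) le21.
  by case/eqP: u21; apply: (@rank_inj s); apply/eqP; rewrite eqn_leq le21 le12.
by rewrite big1// => u1 u1V; have := none u1; rewrite u1V/= => /negbTE ->.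
Qed.

Let within p q u : {set X} := [set v | near p q v <= near p q u].

(** A separating [u] comes first among all points near [p] or [q], and these include [within p q u]
    once [near p q u <= rho]. Using only the latter set makes the probability bound independent of
    [rho]. *)
Lemma separation_count rho p q : 0 <= rho ->
  (\sum_s (first_center s rho p != first_center s rho q)%:R : R) <=
  #|{perm X}|%:R *
    \sum_u (near p q u <= rho < far p q u)%R%:R / #|within p q u|%:R.
Proof.
move=> rho0; pose V := [set v | near p q v <= rho].
apply: (@le_trans _ _ (\sum_s \sum_u
    (near p q u <= rho < far p q u)%R%:R * (s \in first_in u V)%:R)).
  apply: ler_sum => s _; have [_|ne] := eqVneq.
    by apply: sumr_ge0 => u _; rewrite mulr_ge0.
  have [u [h1 h2 h3]] := separated_by rho0 ne.
  rewrite (bigD1 u)//= h1 h2 (_ : s \in first_in u V) ?mulr1; last first.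
    by rewrite inE; apply/forall_inP => v; rewrite inE; exact: h3.
  by rewrite lerDl; apply: sumr_ge0 => v _; rewrite mulr_ge0.
rewrite exchange_big/= mulr_sumr; apply: ler_sum => u _.
have [/andP[h1 h2]|_] := boolP (near p q u <= rho < far p q u); last first.
  by rewrite big1 ?mul0r ?mulr0// => s _; rewrite mul0r.
under eq_bigr do rewrite mul1r; rewrite div1r -natr_sum.
have W0 : (0 < #|within p q u|)%N by apply/card_gt0P; exists u; rewrite inE.
rewrite ler_pdivlMr ?ltr0n// -natrM ler_nat.
have -> : (\sum_s (s \in first_in u V))%N = #|first_in u V|.
  by rewrite -sum1_card [RHS]big_mkcond; apply: eq_bigr => s _; case: ifP.
have uV : u \in V by rewrite inE.
apply: leq_trans (card_first_in uV); rewrite mulnC leq_mul2r.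
rewrite subset_leq_card ?orbT//; apply/fintype.subsetP => v; rewrite !inE => vu.
exact: le_trans vu h1.
Qed.

Variables (M : nat) (r0 : R).
Hypotheses (M0 : (0 < M)%N) (r00 : 0 < r0).

(* [k] is the random choice of scale; the radii of all pairs [(k, j)] form one
   geometric progression of ratio [expR (1 / M)]. *)
Definition radius k j : R := r0 * expR (k%:R / M%:R + j%:R).

Lemma radius_gt0 k j : 0 < radius k j.
Proof. by rewrite mulr_gt0// expR_gt0. Qed.

Lemma radiusSr k j : radius k j.+1 = expR 1 * radius k j.
Proof. by rewrite /radius -natr1 addrA [in LHS]expRD; ring. Qed.

Lemma radius_wrap j : radius M j = radius 0 j.+1.
Proof. by rewrite /radius mul0r add0r divff ?pnatr_eq0 -?lt0n// -natr1 addrC. Qed.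

Lemma radiusSl k j : radius k.+1 j = expR M%:R^-1 * radius k j.
Proof.
rewrite /radius -natr1 mulrDl div1r -addrA [_^-1 + _]addrC addrA.
by rewrite [in LHS]expRD; ring.
Qed.

(* [radius k j <= M (radius k.+1 j - radius k j)], so the sum telescopes
   along the geometric progression of all radii. *)
Lemma radius_sum L lo hi : 0 <= lo -> lo <= hi ->
  \sum_(k < M) \sum_(j < L) radius k j * (lo <= radius k j < hi)%R%:R <=
    M%:R * (expR M%:R^-1 * hi - lo).
Proof.
move=> lo0 lohi; set q := expR _.
have MR : 0 < M%:R :> R by rewrite ltr0n.
have q1 : 1 + M%:R^-1 <= q by exact: expR_ge1Dx.
have q11 : 1 <= q by apply: le_trans q1; rewrite lerDl invr_ge0.
have loq : lo <= q * hi.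
  by rewrite (le_trans lohi)// ler_peMl// (le_trans lo0).
(* Clamping to [[lo, q * hi]]: the upper end leaves room for one step of ratio [q] from a radius
   below [hi]. *)
pose phi t := Num.min (Num.max t lo) (q * hi).
have phi_mono t t' : t <= t' -> phi t <= phi t'.
  move=> tt; rewrite /phi le_min ge_min ge_min lexx orbT andbT.
  by rewrite ge_max !le_max tt lexx !orbT.
have step k j : radius k j * (lo <= radius k j < hi)%R%:R <=
    M%:R * (phi (radius k.+1 j) - phi (radius k j)).
  have rS : radius k j <= radius k.+1 j.
    by rewrite radiusSl ler_peMl// ltW// radius_gt0.
  case: (boolP (_ <= _ < _)) => [/andP[h1 h2]|_]; last first.
    by rewrite mulr0 mulr_ge0// subr_ge0 phi_mono.
  have r_pos := radius_gt0 k j.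
  have qr : q * radius k j <= q * hi by rewrite ler_pM2l ?expR_gt0// ltW.
  have rq : radius k j <= q * hi by rewrite (le_trans rS)// radiusSl.
  rewrite /phi !max_l ?(le_trans h1)// !min_l// ?radiusSl//.
  rewrite mulr1 -/q -ler_pdivrMl// -[X in _ <= _ - X]mul1r -mulrBl.
  by apply: ler_wpM2r; [exact: ltW|lra].
apply: (@le_trans _ _ (\sum_(k < M) \sum_(j < L)
    M%:R * (phi (radius k.+1 j) - phi (radius k j)))).
  by apply: ler_sum => k _; apply: ler_sum => j _; exact: step.
have tele (F : nat -> R) n : \sum_(k < n) (F k.+1 - F k) = F n - F 0.
  by rewrite -(telescope_sumr _ (leq0n n)) big_mkord.
rewrite exchange_big/=.
under eq_bigr => j _.
  rewrite -mulr_sumr (tele (fun k => phi (radius k j))) radius_wrap.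
  over.
rewrite -mulr_sumr ler_wpM2l// (tele (fun j => phi (radius 0 j))).
rewrite lerB// /phi ?ge_min ?lexx ?orbT//.
by rewrite le_min le_max lexx orbT.
Qed.

(** For each [u] the window from [near] to [far] has length at most [mdist p q], and the
    discretization adds at most as much by the choice of [M]. Summing over [u] yields the logarithm
    by [sum_inv_count_le]. *)
Lemma expected_separation L dl p q : 
  (expR M%:R^-1 - 1) * dl <= mdist p q ->
  (forall u v, mdist u v <= dl) ->
  \sum_(s : {perm X}) \sum_(k < M) \sum_(j < L) radius k j *
    (first_center s (radius k j) p != first_center s (radius k j) q)%:R <=
  #|{perm X}|%:R * M%:R * (2 * (1 + ln #|X|%:R) * mdist p q).
Proof.
move=> Mpq dist_le; rewrite exchange_big/=.
under eq_bigr do rewrite exchange_big/=.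
apply: (@le_trans _ _ (\sum_(k < M) \sum_(j < L) radius k j *
   (#|{perm X}|%:R * \sum_u (near p q u <= radius k j < far p q u)%R%:R
      / #|within p q u|%:R))).
  apply: ler_sum => k _; apply: ler_sum => j _; rewrite -mulr_sumr.
  by rewrite ler_wpM2l ?separation_count// ltW// radius_gt0.
have -> : \sum_(k < M) \sum_(j < L) radius k j *
   (#|{perm X}|%:R * \sum_u (near p q u <= radius k j < far p q u)%R%:R
      / #|within p q u|%:R) =
   #|{perm X}|%:R * \sum_u #|within p q u|%:R^-1 *
     \sum_(k < M) \sum_(j < L)
       radius k j * (near p q u <= radius k j < far p q u)%R%:R.
  under eq_bigr => k _.
    under eq_bigr do rewrite mulrCA mulr_sumr.
    rewrite -mulr_sumr exchange_big/=.
    over.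
  rewrite -mulr_sumr exchange_big/=; congr (_ * _); apply: eq_bigr => u _.
  rewrite mulr_sumr; apply: eq_bigr => k _; rewrite mulr_sumr.
  by apply: eq_bigr => j _; rewrite mulrA mulrC.
rewrite -mulrA ler_wpM2l//.
apply: (@le_trans _ _ (\sum_u #|within p q u|%:R^-1 * (M%:R * (2 * mdist p q)))).
  apply: ler_sum => u _; rewrite ler_wpM2l ?invr_ge0//.
  have near0 : 0 <= near p q u by rewrite le_min !mdist_ge0.
  have nf : near p q u <= far p q u by rewrite ge_min !le_max lexx.
  apply: (le_trans (radius_sum L near0 nf)); rewrite ler_wpM2l//.
  have far_le : far p q u <= dl by rewrite ge_max !dist_le.
  have fn : far p q u - near p q u <= mdist p q.
    have := metric_triangle p q u; have := metric_triangle q p u.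
    rewrite (metric_sym q p) /far /near; case: (leP (mdist p u) (mdist q u));
    lra.
  have : (expR M%:R^-1 - 1) * far p q u <= (expR M%:R^-1 - 1) * dl.
    by rewrite ler_wpM2l// subr_ge0 -[leLHS]expR0 ler_expR invr_ge0.
  by lra.
rewrite -mulr_suml mulrCA ler_wpM2l// [leRHS]mulrAC [leRHS]mulrC.
rewrite ler_wpM2r ?mulr_ge0 ?mdist_ge0//.
have := @sum_inv_count_le R X (near p q) [set: X]; rewrite cardsT => H.
have E : \sum_u #|within p q u|%:R^-1 =
    \sum_(u in [set: X])
      #|[set v in [set: X] | near p q v <= near p q u]|%:R^-1 :> R.
  apply: eq_big => [u|u _]; first by rewrite inE.
  by congr (_%:R^-1); apply: eq_card => v; rewrite !inE.
by rewrite E; apply: H; apply/card_gt0P; exists p.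
Qed.

End RandomPartition.

(** * Averaging the random trees into weights on cuts *)

Section CutWeights.
Variables (R : realType) (X : finMetricType R).
Implicit Types (p q u v x : X) (C : {set X}).

Lemma mdist_bounds : exists dmin dmax : R,
  [/\ 0 < dmin, 0 <= dmax, forall p q, p != q -> dmin <= mdist p q &
   forall p q, mdist p q <= dmax].
Proof.
pose dmax : R := \sum_(p : X) \sum_(q : X) mdist p q.
pose dmin : R := \big[Num.min/1]_(p : X) \big[Num.min/1]_(q | q != p) mdist p q.
exists dmin, dmax; split.
- apply: (big_ind (fun t : R => 0 < t)) => // [s t s0 t0|p _].
    by rewrite lt_min s0 t0.
  apply: (big_ind (fun t : R => 0 < t)) => // [s t s0 t0|q qp].
    by rewrite lt_min s0 t0.
  by rewrite mdist_gt0 eq_sym.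
- by apply: sumr_ge0 => p _; apply: sumr_ge0 => q _; exact: mdist_ge0.
- move=> p q pq; rewrite /dmin (bigD1 p)//= ge_min (bigD1 q) ?ge_min ?lexx//.
  by rewrite eq_sym.
- move=> p q; rewrite /dmax (bigD1 p)//= (bigD1 q)//= -addrA lerDl addr_ge0//.
    by apply: sumr_ge0 => v _; exact: mdist_ge0.
  by apply: sumr_ge0 => u _; apply: sumr_ge0 => v _; exact: mdist_ge0.
Qed.

Lemma expR_inv_nat_le (a b : R) : 0 < a -> 0 <= b ->
  exists2 M : nat, (0 < M)%N & (expR M%:R^-1 - 1) * b <= a.
Proof.
move=> a0 b0; pose M := (Num.truncn (2 * b / a)).+2.
have MR : 2 <= M%:R :> R by rewrite ler_nat.
have M0 : 0 < M%:R :> R by rewrite ltr0n.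
exists M => //; set y := M%:R^-1.
have y0 : 0 < y by rewrite invr_gt0.
have y2 : y <= 2^-1 by rewrite lef_pV2 ?posrE.
have ey : expR y - 1 <= 2 * y.
  have h : expR y <= (1 - y)^-1 by apply: expR_le_inv; lra.
  have h2 : (1 - y)^-1 <= 1 + 2 * y.
    rewrite -[leLHS]mul1r ler_pdivrMr; nra.
  lra.
apply: (@le_trans _ _ (2 * y * b)); first by rewrite ler_wpM2r.
rewrite -mulrA mulrCA mulrC /y ler_pdivrMr// [leRHS]mulrC -ler_pdivrMr//.
apply: ltW; apply: (lt_le_trans (truncnS_gt _)).
by rewrite ler_nat.
Qed.

(** The 8 of [tree_stretch] times the 2 of [expected_separation], and one ratio [expR 1] for passing
    from [r j.+1] to [r j]. *)
Definition tree_const : R := 16 * expR 1.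

Lemma random_tree_weights (dmin dmax : R) (M L : nat) : (0 < M)%N -> (0 < L)%N ->
  0 < dmin -> (forall p q, p != q -> dmin <= mdist p q) ->
  (forall p q, mdist p q <= dmax) -> (expR M%:R^-1 - 1) * dmax <= dmin ->
  dmax <= dmin / expR 1 * expR L%:R ->
  exists tw : {perm X} * 'I_M -> {set X} -> R, [/\ forall o C, 0 <= tw o C,
    forall o x, dmin <= tw o [set x], forall o, tw o finset.set0 = 0 &
   [/\ forall o (mu : LF X), LF_norm mu <= \sum_C tw o C * `|\sum_(x in C) mu x|,
    forall o, (#|[set C | tw o C != 0%R]| <= #|X| * #|X|.+1)%N &
    forall p q, \sum_o \sum_C tw o C * cut C p q <=
      #|{: {perm X} * 'I_M}|%:R * (tree_const * (1 + ln #|X|%:R) * mdist p q)]].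
Proof.
move=> M0 L0 dmin0 dminP dmaxP Mdmax Ldmax.
(* Level-0 radii stay below [dmin], so every point is its own center there, while level-1 radii are
   at least [dmin]. *)
pose r0 := dmin / expR 1.
have r00 : 0 < r0 by rewrite divr_gt0// expR_gt0.
pose c (o : {perm X} * 'I_M) j := first_center o.1 (radius M r0 o.2 j).
pose r (o : {perm X} * 'I_M) j := radius M r0 o.2 j.
pose D o j := 2 * r o j.
have r_gt0 o j : 0 < r o j by exact: radius_gt0.
have D0 o j : 0 <= D o j by rewrite mulr_ge0// ltW.
have e2 : 2 <= expR 1 :> R by exact: expR_ge1Dx.
have r2 o j : 2 * r o j <= r o j.+1.
  by rewrite /r radiusSr ler_pM2r ?radius_gt0.
have centerP o j x : mdist x (c o j x) <= r o j.
  by have [] := first_centerP o.1 x (ltW (r_gt0 o j)).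
have M0R : 0 < M%:R :> R by rewrite ltr0n.
have r0lt o : r o 0 < dmin.
  rewrite /r /radius addr0 /r0 -mulrA gtr_pMr// mulrC ltr_pdivrMr ?expR_gt0//.
  by rewrite mul1r ltr_expR ltr_pdivrMr// mul1r ltr_nat.
have eqv0 o x y : eqv L (c o) 0 x y -> x = y.
  move=> /(eqv_center L0).
  have self z : c o 0 z = z.
    apply/eqP/negPn/negP; rewrite eq_sym => /dminP; rewrite leNgt.
    by rewrite (le_lt_trans (centerP o 0 z)).
  by rewrite !self.
have eqvD o i x y : (i <= L)%N -> eqv L (c o) i x y -> mdist x y <= D o i.
  (* The top cluster is all of [X], whose diameter the choice of [L] covers; below, points with a
     common center are within twice the radius. *)
  rewrite leq_eqVlt => /orP[/eqP -> _|iL /(eqv_center iL) xy].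
    apply: (le_trans (dmaxP x y)); apply: (le_trans Ldmax).
    apply: (@le_trans _ _ (r o L)); last by rewrite /D ler_peMl ?ltW//; lra.
    by rewrite /r /radius -/r0 ler_pM2l// ler_expR lerDr divr_ge0.
  apply: (le_trans (metric_triangle x (c o i x) y)).
  rewrite /D mulr2n mulrDl mul1r.
  by apply: lerD; [|rewrite xy metric_sym]; exact: centerP.
exists (fun o => tree_weight L (c o) (D o)); split.
- by move=> o C; exact: tree_weight_ge0.
- move=> o x; apply: le_trans (tree_weight_set1 (D0 o) (eqv0 o) x L0).
  rewrite /D /r radiusSr /radius /r0 addr0.
  rewrite (_ : 2 * _ = 2 * expR (o.2%:R / M%:R) * dmin); last first.
    by field; rewrite gt_eqF// expR_gt0.
  rewrite ler_peMl ?ltW//.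
  have : expR 0 <= expR (o.2%:R / M%:R) :> R by rewrite ler_expR divr_ge0.
  by rewrite expR0; lra.
- by move=> o; exact: tree_weight_set0.
split=> [t mu|t|p q]; first exact: (LF_norm_le_tree (eqv0 t) (eqvD t)).
  exact: card_tree_weight.
apply: (@le_trans _ _ (\sum_o 8 * expR 1 *
   \sum_(j < L) r o j * (c o j p != c o j q)%:R)).
  apply: ler_sum => t _.
  have rt0 j := ltW (r_gt0 t j).
  apply: (le_trans (tree_stretch L (c t) (D0 t) rt0 (r2 t) (fun=> erefl) p q)).
  rewrite -mulrA ler_wpM2l// mulr_sumr; apply: ler_sum => j _.
  by rewrite /r radiusSr mulrA.
rewrite -mulr_sumr.
rewrite -(pair_bigA _ (fun (s : {perm X}) (k : 'I_M) => \sum_(j < L)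
  radius M r0 k j * (first_center s (radius M r0 k j) p
    != first_center s (radius M r0 k j) q)%:R))/=.
have [<-|pq] := eqVneq p q.
  rewrite big1 => [|s _]; last first.
    by rewrite big1// => k _; rewrite big1// => j _; rewrite eqxx mulr0.
  by rewrite mdistxx !mulr0.
have H := @expected_separation _ _ _ _ M0 r00 L dmax p q
  (le_trans Mdmax (dminP _ _ pq)) dmaxP.
apply: (@le_trans _ _ (8 * expR 1 * (#|{perm X}|%:R * M%:R *
    (2 * (1 + ln #|X|%:R) * mdist p q)))).
  by rewrite ler_wpM2l// mulr_ge0// expR_ge0.
by rewrite card_prod card_ord natrM /tree_const le_eqVlt; apply/orP; left;
  apply/eqP; ring.
Qed.

Lemma cut_weights : (2 <= #|X|)%N -> exists W : {set X} -> R,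
  [/\ forall C, 0 <= W C, forall x, 0 < W [set x], W finset.set0 = 0 &
  [/\ forall mu : LF X, LF_norm mu <= \sum_C W C * `|\sum_(x in C) mu x|,
      forall p q, \sum_C W C * cut C p q
        <= tree_const * (1 + ln #|X|%:R) * mdist p q &
      (#|[set C | W C != 0%R]| <= (#|X| * #|X|).+1 * (#|X| * #|X|.+1))%N]].
Proof.
move=> X2.
have [dmin [dmax [dmin0 dmax0 dminP dmaxP]]] := mdist_bounds.
have [M M0 Mdmax] := expR_inv_nat_le dmin0 dmax0.
have [L L0 Ldmax] : exists2 L, (0 < L)%N & dmax <= dmin / expR 1 * expR L%:R.
  pose t := dmax / (dmin / expR 1); exists (Num.truncn t).+1 => //.
  rewrite mulrC -ler_pdivrMr ?divr_gt0 ?expR_gt0//.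
  apply: (le_trans (ltW (truncnS_gt t))); set N : R := _%:R.
  by have := expR_ge1Dx N; lra.
have [tw [tw0 tw1 tws [tw_dom tw_card tw_cut]]] :=
  random_tree_weights M0 L0 dmin0 dminP dmaxP Mdmax Ldmax.
pose O : finType := ({perm X} * 'I_M)%type.
have O0 : 0 < #|O|%:R :> R.
  rewrite ltr0n; apply/card_gt0P.
  by exists (1%g, Ordinal M0).
(* The coordinate [None] records the total weight, so the reduced weights still form a convex
   combination. Domination survives any such combination, and the other coordinates preserve the
   average stretches. *)
pose f (o : O) (k : option (X * X)) : R :=
  if k is Some (p, q) then \sum_C tw o C * cut C p q else 1.
have [w [w0 wf w_supp]] := @caratheodory R O _ f (fun=> #|O|%:R^-1)
  (fun=> ltac:(by rewrite invr_ge0)).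
have w1 : \sum_o w o = 1.
  have := wf None; under eq_bigr do rewrite mulr1; move=> ->.
  under eq_bigr do rewrite mulr1.
  by rewrite sumr_const -[LHS]mulr_natr mulVf// gt_eqF.
pose W C := \sum_o w o * tw o C.
have sumW (F : {set X} -> R) :
    \sum_C W C * F C = \sum_o w o * \sum_C tw o C * F C.
  under eq_bigr do rewrite mulr_suml; rewrite exchange_big/=.
  apply: eq_bigr => o _; rewrite mulr_sumr; apply: eq_bigr => C _.
  by rewrite mulrA.
exists W; split.
- by move=> C; apply: sumr_ge0 => o _; rewrite mulr_ge0.
- move=> x; apply: (lt_le_trans dmin0); rewrite -[leLHS]mul1r -w1 mulr_suml.
  by apply: ler_sum => o _; rewrite ler_wpM2l.
- by rewrite /W big1// => o _; rewrite tws mulr0.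
split.
- move=> mu; rewrite sumW -[leLHS]mul1r -w1 mulr_suml.
  by apply: ler_sum => o _; rewrite ler_wpM2l.
- move=> p q; rewrite sumW; have := wf (Some (p, q)) => /= ->.
  by rewrite -mulr_sumr mulrC ler_pdivrMr// mulrC.
rewrite -card_prod -(card_option (X * X)%type).
apply: (@leq_trans #|\bigcup_(o in [set o | w o != 0%R]) [set C | tw o C != 0%R]|).
  apply/subset_leq_card/fintype.subsetP => C; rewrite inE => WC.
  apply/bigcupP; apply: contrapT => noC; move/eqP: WC; apply.
  rewrite /W big1// => o _; apply/eqP/negPn/negP; rewrite mulf_eq0 negb_or.
  by move=> /andP[wo to]; apply: noC; exists o; rewrite inE.
apply: (@leq_trans (\sum_(o in [set o | w o != 0%R]) #|X| * #|X|.+1)%N).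
  elim/big_rec2: _ => [|o n A _ IH]; first by rewrite cards0.
  by rewrite (leq_trans (leq_card_setU _ _))// leq_add.
by rewrite sum_nat_const leq_mul2r w_supp orbT.
Qed.

End CutWeights.

(** * The embedding *)

Section OpNorm.
Variables (R : realType) (E F : normedModType R).

Lemma op_norm_le (A : set E) (f : E -> F) (c : R) :
  (forall x, A x -> `|x| <= 1 -> `|f x| <= c) -> (op_norm A f <= c%:E)%E.
Proof.
move=> fc; apply: ge_ereal_sup => _ [x [Ax x1] <-].
by rewrite lee_fin fc.
Qed.

Lemma op_norm_ge0 (A : set E) (f : E -> F) x : A x -> `|x| <= 1 ->
  (0 <= op_norm A f)%E.
Proof.
move=> Ax x1; apply: (@le_trans _ _ (`|f x|%:E)); first by rewrite lee_fin.
by apply: ereal_sup_ubound; exists x.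
Qed.

End OpNorm.

Lemma embeds_of_bounds (R : realType) (E F : normedModType R)
    (T : {linear E -> F}) (a b D : R) :
  0 <= a -> 0 <= b -> (forall x, `|T x| <= a * `|x|) ->
  (forall x, `|x| <= b * `|T x|) -> a * b <= D -> embeds_with_distortion E F D.
Proof.
move=> a0 b0 Ta Tb abD.
have Tinj : injective T.
  move=> x y Txy; apply/eqP; rewrite -subr_eq0 -normr_le0.
  by rewrite (le_trans (Tb _))// linearB/= Txy subrr normr0 mulr0.
pose S y := xget 0 [set x | T x = y]%classic.
have TK : cancel T S.
  move=> x; apply: Tinj; apply: (@xgetPex _ 0 [set z | T z = T x]%classic).
  by exists x.
exists T, S; split => //.
apply: (@le_trans _ _ (a%:E * b%:E)%E); last by rewrite -EFinM lee_fin.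
apply: lee_pmul.
- by apply: (@op_norm_ge0 _ _ _ _ _ 0); rewrite // normr0.
- by apply: (@op_norm_ge0 _ _ _ _ _ (T 0)); [exists 0|rewrite linear0 normr0].
- apply: op_norm_le => x _ x1; apply: (le_trans (Ta x)).
  by rewrite -[leRHS]mulr1 ler_wpM2l.
- apply: op_norm_le => _ [x _ <-] x1; rewrite TK; apply: (le_trans (Tb x)).
  by rewrite -[leRHS]mulr1 ler_wpM2l.
Qed.

Section CoordMap.
Variables (R : realType) (X : finMetricType R).

Definition LF_col (mu : LF X) : 'cV[R]_#|X| := \col_k mu (enum_val k).

Definition coord_map m (b : 'I_m -> 'cV[R]_#|X|) (mu : LF X) : ell1 R m :=
  \row_j dot (b j) (LF_col mu).

Lemma coord_map_linear m (b : 'I_m -> 'cV[R]_#|X|) : linear (coord_map b).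
Proof.
move=> t u v; apply/rowP => j; rewrite !mxE -dotZr -dotDr; congr dot.
by apply/colP => k; rewrite !mxE !ffunE.
Qed.

HB.instance Definition _ m (b : 'I_m -> 'cV[R]_#|X|) :=
  GRing.isLinear.Build R (LF X) (ell1 R m) *:%R (coord_map b)
    (coord_map_linear b).

Lemma norm_coord_map m (b : 'I_m -> 'cV[R]_#|X|) mu :
  `|coord_map b mu| = l1 b (LF_col mu).
Proof. by rewrite /l1; apply: eq_bigr => j _; rewrite mxE. Qed.

Definition cut_row (W : {set X} -> R) (C : {set X}) : 'cV[R]_#|X| :=
  \col_k (W C * (enum_val k \in C)%:R).

Lemma dot_cut_row W C mu :
  dot (cut_row W C) (LF_col mu) = W C * \sum_(x in C) mu x.
Proof.
rewrite dotE [in RHS]big_mkcond/= mulr_sumr.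
rewrite (reindex (enum_val (A := X)))/=; last exact/onW_bij/enum_val_bij.
apply: eq_bigr => k _; rewrite !mxE -mulrA; congr (_ * _).
by case: ifP; rewrite ?mul1r ?mul0r.
Qed.

End CoordMap.

Theorem theorem15 (R : realType) :
  exists K1 K2 : R, 0 < K1 /\ 0 < K2 /\
    forall X : finMetricType R, (2 <= #|X|)%N ->
      exists m : nat,
        m%:R <= K1 * #|X|%:R * log2 (#|X|%:R : R) /\
        embeds_with_distortion (LF X) (ell1 R m) (K2 * log2 (#|X|%:R : R)).
Proof.
have ln2 : 0 < ln 2 :> R by rewrite ln_gt0// ltr1n.
have := @l1_sparsify R; move: (sparse_const R) (sparse_const_gt0 R).
move=> c c0 sparsify.
have : 0 < tree_const R by rewrite mulr_gt0 ?expR_gt0.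
have := @cut_weights R; move: (tree_const R) => t cut_weights t0.
(* The 8 comes from [l = 8 * ln n], and [ln 2] changes the base. The [16 / 9] is the two-sided
   sparsification loss [4 / 3] squared, and [1 + ln n <= (1 + ln 2) * log2 n] as [n >= 2]. *)
exists (c * 8 * ln 2), (16 / 9 * t * (1 + ln 2)).
split; first by rewrite mulr_gt0 ?mulr_gt0.
split; first by rewrite mulr_gt0// ?addr_gt0// mulr_gt0// divr_gt0.
move=> X X2; set n := #|X|.
have [W [W0 W1 Ws [W_dom W_cut W_card]]] := cut_weights _ X2.
have n0 : 0 < n%:R :> R by rewrite ltr0n (leq_trans _ X2).
have lnn : ln 2 <= ln n%:R :> R by rewrite ler_ln ?posrE// ler_nat.
have n_gt0 : (0 < n)%N by rewrite (leq_trans _ X2).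
pose S := [set C | W C != 0%R].
pose a (i : 'I_#|S|) := cut_row W (enum_val i).
have [x0 _] : exists x0 : X, x0 \in X by apply/card_gt0P.
have S1 x : [set x] \in S by rewrite inE gt_eqF.
have S0 : (0 < #|'I_#|S| |)%N by rewrite card_ord; apply/card_gt0P; exists [set x0].
(* The rows of the singletons, which have positive weight, already determine every coordinate, also
   without the zero-sum condition. *)
have spa : spanning a.
  move=> x ax; apply/colP => k; rewrite mxE.
  have := ax (enum_rank_in (S1 x0) [set enum_val k]).
  rewrite /a enum_rankK_in// dotE (bigD1 k)//= big1 => [|j jk].
    rewrite mxE inE eqxx mulr1 addr0 => /eqP; rewrite mulf_eq0 gt_eqF//.
    by move/eqP.
  by rewrite mxE inE (inj_eq enum_val_inj) (negbTE jk) mulr0 mul0r.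
have a0 i : a i != 0.
  have := enum_valP i; rewrite inE /a; set C := enum_val i => WC.
  have [y yC] : exists y, y \in C.
    by apply/set0Pn; apply: contra_neq WC => ->.
  apply: contra_neq WC => /colP/(_ (enum_rank y)).
  by rewrite !mxE enum_rankK yC mulr1.
have l0 : 0 < 8 * ln n%:R :> R by rewrite mulr_gt0// (lt_le_trans ln2).
(* Carathéodory leaves at most [n ^ 2 + 1] trees with at most [n * (n + 1)] clusters each; four
   times their product is at most [n ^ 8]. *)
have lS : ln (4 * #|'I_#|S| |%:R) <= 8 * ln n%:R :> R.
  rewrite card_ord [leRHS]mulr_natl -lnXn// -natrX -natrM.
  rewrite ler_ln ?posrE ?ltr0n ?muln_gt0 ?expn_gt0 ?n_gt0 ?andbT//=; last first.
    by move: S0; rewrite card_ord.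
  rewrite ler_nat; apply: (@leq_trans (4 * ((n * n).+1 * (n * n.+1)))%N).
    by rewrite leq_mul2l/= W_card.
  have n4 : (4 <= n ^ 2)%N by rewrite -[4%N]/(2 ^ 2)%N leq_exp2r.
  have n3 : ((n * n).+1 <= n ^ 3)%N by rewrite mulnn ltn_exp2l.
  have n21 : (n.+1 <= n ^ 2)%N by rewrite -{1}[n]expn1 ltn_exp2l.
  have -> : (n ^ 8 = n ^ 2 * (n ^ 3 * (n * n ^ 2)))%N.
    by rewrite -expnS -!expnD.
  by rewrite leq_mul// leq_mul// leq_mul.
have [m [b [mC bb]]] := sparsify _ _ _ _ n_gt0 l0 S0 spa a0 lS.
exists m; split.
  apply: (le_trans mC); rewrite /log2 le_eqVlt; apply/orP; left; apply/eqP.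
  by field; rewrite gt_eqF.
have l1a (mu : LF X) : l1 a (LF_col mu) = \sum_C W C * `|\sum_(x in C) mu x|.
  rewrite /l1 -(big_enum_val (fun C => `|dot (cut_row W C) (LF_col mu)|))/=.
  rewrite big_mkcond/=; apply: eq_bigr => C _; rewrite inE dot_cut_row normrM.
  by case: eqP => [->|_]/=; rewrite ?mul0r// (ger0_norm (W0 C)).
set D := t * (1 + ln n%:R).
have D0 : 0 <= D.
  by rewrite mulr_ge0 ?ltW// addr_gt0// (lt_le_trans ln2).
apply: (@embeds_of_bounds _ _ _ (coord_map b) (4 / 3 * D) (4 / 3)).
- by rewrite mulr_ge0// divr_ge0.
- by rewrite divr_ge0.
- move=> mu; rewrite norm_coord_map.
  have [_ h] := bb (LF_col mu); rewrite l1a in h.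
  have := cut_sum_le_LF_norm mu W0 D0 W_cut; rewrite -[LF_norm mu]/(`|mu|).
  move: h; set s := \sum_C _; lra.
- move=> mu; rewrite norm_coord_map.
  have [h _] := bb (LF_col mu); rewrite l1a in h.
  have := W_dom mu; rewrite -[LF_norm mu]/(`|mu|).
  move: h; set s := \sum_C _; lra.
- rewrite (_ : 4 / 3 * D * (4 / 3) = 16 / 9 * t * (1 + ln n%:R)); last first.
    by rewrite /D; field.
  rewrite -[leRHS]mulrA; apply: ler_wpM2l.
    by rewrite mulr_ge0 ?divr_ge0 ?ltW.
  rewrite /log2 mulrA ler_pdivlMr// !mulrDl !mul1r.
  by rewrite [ln n%:R * _]mulrC lerD2r.
Qed.
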